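(* Assume (H1), (H3) and (H6). Let $c=(c(n))_{n\in\mathbb{Z}}$ be defined by \[ c(n)=\sum_{k=-\infty}^{+\infty}\mathcal{G}(n,k)\,h(k),\qquad n\in\mathbb{Z}. \] Then $c$ is the unique almost periodic solution of the linear inhomogeneous difference system \[ c(n+1)=H(n)c(n)+h(n),\qquad n\in\mathbb{Z}. \] Moreover, \[ |c|_{\infty}\le \frac{2K}{1-\rho}\,|h|_{\infty}. \]
   Context: Let $q\in\mathbb{N}$. $|\cdot|$ denotes the Euclidean norm on every finite-dimensional space (for matrices, the Euclidean norm of the array of entries), and for $g:D\to E$, $|g|_\infty=\sup_{t\in D}|g(t)|$. Fix a real sequence $(t_n)_{n\in\mathbb{Z}}$ with $t_n<t_{n+1}$ and $t_n\to\pm\infty$ as $n\to\pm\infty$; put $t^{(k)}_n=t_{n+k}-t_n$. A set $E\subseteq\mathbb{R}$ (or $\subseteq\mathbb{Z}$) is relatively dense if there is $l>0$ with $E\cap[m,m+l]\neq\emptyset$ for all $m\in\mathbb{R}$. For $\mathbb{A}\in\{\mathbb{R},\mathbb{Z}\}$ and a finite-dimensional normed space $E$, a continuous $g:\mathbb{A}\to E$ is almost periodic if for every $\varepsilon>0$ the set $T(g,\varepsilon)=\{\tau\in\mathbb{A}:|g(t+\tau)-g(t)|\le\varepsilon\ \forall t\in\mathbb{A}\}$ is relatively dense. Let $A,B:\mathbb{R}\to M_q(\mathbb{C})$ and $f:\mathbb{R}\to\mathbb{C}^q$ be locally integrable. Let $X$ be a fundamental matrix of $x'=A(t)x$ and $X(t,s)=X(t)X(s)^{-1}$.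 For $n\in\mathbb{Z}$ and $t\in[t_n,t_{n+1}]$ let $\mathcal{J}_n(t)=I+\int_{t_n}^tX(t_n,u)B(u)\,du$; it is assumed throughout that $\mathcal{J}_n(t)$ is invertible for all $n\in\mathbb{Z}$, $t\in[t_n,t_{n+1}]$. Let $Z_n(t)=X(t,t_n)\mathcal{J}_n(t)$, $H(n)=Z_n(t_{n+1})$, and $h(n)=\int_{t_n}^{t_{n+1}}X(t_{n+1},u)f(u)\,du$. Hypotheses: (H1) $A$ and $B$ are almost periodic. (H2) For every $\varepsilon>0$ the set $\bigcap_{k\in\mathbb{N}}\{T\in\mathbb{Z}: |t^{(k)}_{T+n}-t^{(k)}_n|\le\varepsilon \text{ for all } n\in\mathbb{Z}\}$ is relatively dense. (H3) (H2) holds, and for every $\varepsilon>0$ the set $\{\tau\in\mathbb{R}: |f(t+\tau)-f(t)|\le\varepsilon \text{ for all } t\in\mathbb{R}\setminus\bigcup_{n\in\mathbb{Z}}(t_n-\varepsilon,t_n+\varepsilon)\}$ is relatively dense, and there is $\delta_\varepsilon>0$ such that $|f(t'+\tau')-f(t')|\le\varepsilon$ whenever $|\tau'|\le\delta_\varepsilon$ and $t',t'+\tau'$ lie in a common interval $[t_n,t_{n+1}]$. (H6) Let $\Phi$ be a fundamental matrix of $\phi(n+1)=H(n)\phi(n)$ (i.e. $\Phi(n+1)=H(n)\Phi(n)$, $\Phi(n)$ invertible). There are a projection $\Pi$ on $\mathbb{C}^q$ and constants $K>0$, $0<\rho<1$ such that $|\mathcal{G}(n,k)|\le K\rho^{|n-k|}$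 for all $n,k\in\mathbb{Z}$, where $\mathcal{G}(n,k)=\Phi(n)\Pi\Phi(k+1)^{-1}$ if $n>k$ and $\mathcal{G}(n,k)=-\Phi(n)(I-\Pi)\Phi(k+1)^{-1}$ if $n\le k$. *)

(* Defs.v *)
From HB Require Import structures.
From mathcomp Require Import all_boot all_order all_algebra.
From mathcomp Require Import all_classical all_reals all_analysis.
From mathcomp Require Import complex.
Set Implicit Arguments. Unset Strict Implicit. Unset Printing Implicit Defensive.
Import Order.TTheory GRing.Theory Num.Theory.
Import numFieldNormedType.Exports.
Local Open Scope classical_set_scope.
Local Open Scope ring_scope.

Section Defs.
Variable R : realType.
Local Notation C := (R[i]).

Definition vnorm (m n : nat) (M : 'M[C]_(m, n)) : R :=
  Num.sqrt (\sum_(i < m) \sum_(j < n)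
     (complex.Re (M i j) ^+ 2 + complex.Im (M i j) ^+ 2)).

Definition supnormZ (m n : nat) (g : int -> 'M[C]_(m, n)) : \bar R :=
  ereal_sup [set (vnorm (g k))%:E | k in [set: int]].

Definition cint (m n : nat) (a b : R) (F : R -> 'M[C]_(m, n)) : 'M[C]_(m, n) :=
  \matrix_(i, j)
    (Complex (Rintegral lebesgue_measure `[a, b] (fun u => complex.Re (F u i j)))
             (Rintegral lebesgue_measure `[a, b] (fun u => complex.Im (F u i j)))).

Definition loc_integrable (m n : nat) (F : R -> 'M[C]_(m, n)) : Prop :=
  forall (a b : R) (i : 'I_m) (j : 'I_n),
    lebesgue_measure.-integrable `[a, b] (EFin \o (fun u => complex.Re (F u i j))) /\
    lebesgue_measure.-integrable `[a, b] (EFin \o (fun u => complex.Im (F u i j))).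

Definition mx_continuous (m n : nat) (F : R -> 'M[C]_(m, n)) : Prop :=
  forall (t e : R), 0 < e -> exists2 d : R, 0 < d &
    forall s : R, `|s - t| < d -> vnorm (F s - F t) < e.

Definition reldense_R (E : set R) : Prop :=
  exists2 l : R, 0 < l & forall m : R, exists2 tau : R, E tau & m <= tau <= m + l.
Definition reldense_Z (E : set int) : Prop :=
  exists2 l : R, 0 < l & forall m : R, exists2 T : int, E T & m <= T%:~R <= m + l.

Definition almost_periodic_R (m n : nat) (g : R -> 'M[C]_(m, n)) : Prop :=
  mx_continuous g /\
  forall e : R, 0 < e ->
    reldense_R [set tau : R | forall t : R, vnorm (g (t + tau) - g t) <= e].

(* almost periodicity on Z (continuity is automatic) *)
Definition almost_periodic_Z (m n : nat) (g : int -> 'M[C]_(m, n)) : Prop :=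
  forall e : R, 0 < e ->
    reldense_Z [set T : int | forall k : int, vnorm (g (k + T) - g k) <= e].

(* X is a fundamental matrix of x' = A(t) x (Caratheodory sense):
   X is continuous, satisfies the integral equation and is invertible *)
Definition fundamental_matrix (q : nat) (A X : R -> 'M[C]_q) : Prop :=
  mx_continuous X /\
  (forall s t : R, s <= t -> X t = X s + cint s t (fun u => A u *m X u)) /\
  (forall t : R, X t \in unitmx).

Definition Xts (q : nat) (X : R -> 'M[C]_q) (t s : R) : 'M[C]_q :=
  X t *m invmx (X s).

Definition Jn (q : nat) (X B : R -> 'M[C]_q) (tt : int -> R) (n : int) (t : R)
  : 'M[C]_q := 1%:M + cint (tt n) t (fun u => Xts X (tt n) u *m B u).

Definition Zn (q : nat) (X B : R -> 'M[C]_q) (tt : int -> R) (n : int) (t : R)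
  : 'M[C]_q := Xts X t (tt n) *m Jn X B tt n t.

Definition Hmat (q : nat) (X B : R -> 'M[C]_q) (tt : int -> R) (n : int)
  : 'M[C]_q := Zn X B tt n (tt (n + 1)).

Definition hvec (q : nat) (X : R -> 'M[C]_q) (f : R -> 'cV[C]_q) (tt : int -> R)
  (n : int) : 'cV[C]_q := cint (tt n) (tt (n + 1)) (fun u => Xts X (tt (n + 1)) u *m f u).

Definition Green (q : nat) (Phi : int -> 'M[C]_q) (Pi : 'M[C]_q) (n k : int)
  : 'M[C]_q :=
  if k < n then Phi n *m Pi *m invmx (Phi (k + 1))
  else - (Phi n *m (1%:M - Pi) *m invmx (Phi (k + 1))).

Definition green_psum (q : nat) (Phi : int -> 'M[C]_q) (Pi : 'M[C]_q)
  (h : int -> 'cV[C]_q) (n : int) (N : nat) : 'cV[C]_q :=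
  \sum_(0 <= i < (N + N).+1) Green Phi Pi n (i%:Z - N%:Z) *m h (i%:Z - N%:Z).

Definition green_sum (q : nat) (Phi : int -> 'M[C]_q) (Pi : 'M[C]_q)
  (h : int -> 'cV[C]_q) (n : int) : 'cV[C]_q :=
  \matrix_(i, j)
    (Complex (lim ((fun N => complex.Re (green_psum Phi Pi h n N i j)) @ \oo))
             (lim ((fun N => complex.Im (green_psum Phi Pi h n N i j)) @ \oo))).

End Defs.

(* Main.v *)
(** The intervals [t_n, t_(n+1)] being closed, the hypothesis on [f] makes it
    uniformly continuous across the nodes, hence almost periodic in the sense of
    Bohr.  Almost periodicity means that the translates fall into finitely many
    classes at each scale; colouring each integer [a] by the classes of the
    translates of [A], [B], [f] by [t_a] and of [(t_n)] by [a], two integers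
    [a], [b] of the same colour give common almost periods [T = b - a] and
    [tau = t_b - t_a].  Gronwall estimates on the propagator [X(t) X(s)^-1],
    [s <= t], turn these into common almost periods of [H] and [h].  The series
    is the only bounded solution of the difference system, and
    [c(n + T) - c(n)] is the bounded solution of the same system with a small
    forcing term, so the estimate of the Green operator makes it small. *)

Require Import Defs.
From HB Require Import structures.
From mathcomp Require Import all_boot all_order all_algebra.
From mathcomp Require Import all_classical all_reals all_analysis.
From mathcomp Require Import complex.
From mathcomp Require Import ring lra zify.
Import Order.TTheory GRing.Theory Num.Theory.
Import numFieldNormedType.Exports.
Local Open Scope classical_set_scope.
Local Open Scope ring_scope.

Set Implicit Arguments.
Unset Strict Implicit.
Unset Printing Implicit Defensive.

(** * Euclidean norm *)

Section EuclideanNorm.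
Variable R : realType.
Local Notation C := (R[i]).
Local Notation normc := ComplexField.Normc.normc.

(** Two obstacles shape the argument. Relatively dense sets need not have a relatively dense
    intersection, and the integer period T has to be tied to a real period tau; colourings can be
    multiplied, and [tau = t_b - t_a] carries every node t_n close to t_(n+T), so one colouring
    settles both. The translated interval then matches the target only up to small errors at its
    ends, so estimates for translation are paired with estimates for moving the end points. X(t)
    itself may be unbounded: only X(t) X(s)^-1 on windows of bounded length is estimated, which is
    enough because the gaps between nodes are bounded. With the propagator taken into the integral,
    H(n) is X(t_(n+1), t_n) plus a Duhamel integral of B, and h(n) is a Duhamel integral of f, so
    one set of lemmas serves both. Integrating entry by entry costs crude dimensional factors, but
    these affect only almost periodicity; the factor 2K/(1 - rho) comes from the two-sided geometric
    series alone. *)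

Lemma Cauchy_Schwarz_sum (I : finType) (a b : I -> R) :
  (\sum_i a i * b i) ^+ 2 <= (\sum_i a i ^+ 2) * (\sum_i b i ^+ 2).
Proof.
(* Lagrange's identity: this double sum is twice the right-hand side minus the left-hand side. *)
have : 0 <= \sum_i \sum_j (a i * b j - a j * b i) ^+ 2.
  by apply: sumr_ge0 => i _; apply: sumr_ge0 => j _; exact: sqr_ge0.
have E i j : (a i * b j - a j * b i) ^+ 2 = a i ^+ 2 * b j ^+ 2
    + b i ^+ 2 * a j ^+ 2 - 2 * ((a i * b i) * (a j * b j)) by ring.
rewrite (_ : \sum_i _ = (\sum_i a i ^+ 2) * (\sum_i b i ^+ 2) +
   (\sum_i b i ^+ 2) * (\sum_i a i ^+ 2)
   - 2 * ((\sum_i a i * b i) * (\sum_i a i * b i))); first by rewrite expr2; lra.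
rewrite !big_distrl /= mulr_sumr -sumrN -!big_split /=; apply: eq_bigr => i _.
rewrite !big_distrr /= -sumrN -!big_split /=; apply: eq_bigr => j _.
exact: E.
Qed.

Lemma normcE2 (z : C) : normc z ^+ 2 = complex.Re z ^+ 2 + complex.Im z ^+ 2.
Proof.
by case: z => x y /=; rewrite sqr_sqrtr // addr_ge0 // sqr_ge0.
Qed.

Lemma normc_ge0 (z : C) : 0 <= normc z.
Proof. by case: z => x y; exact: sqrtr_ge0. Qed.

Lemma vnorm_normc (m n : nat) (M : 'M[C]_(m, n)) :
  vnorm M = Num.sqrt (\sum_(p : 'I_m * 'I_n) normc (M p.1 p.2) ^+ 2).
Proof.
rewrite /vnorm pair_bigA /=; congr Num.sqrt.
by apply: eq_bigr => p _; rewrite normcE2.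
Qed.

Lemma vnorm_ge0 (m n : nat) (M : 'M[C]_(m, n)) : 0 <= vnorm M.
Proof. exact: sqrtr_ge0. Qed.

Lemma vnorm_sqr (m n : nat) (M : 'M[C]_(m, n)) :
  vnorm M ^+ 2 = \sum_(p : 'I_m * 'I_n) normc (M p.1 p.2) ^+ 2.
Proof.
by rewrite vnorm_normc sqr_sqrtr //; apply: sumr_ge0 => p _; exact: sqr_ge0.
Qed.

Lemma vnorm_le_sqr (m n : nat) (M : 'M[C]_(m, n)) (x : R) :
  0 <= x -> vnorm M ^+ 2 <= x ^+ 2 -> vnorm M <= x.
Proof. by move=> x0; rewrite ler_sqr ?nnegrE ?vnorm_ge0. Qed.

Lemma ler_vnormD (m n : nat) (M N : 'M[C]_(m, n)) :
  vnorm (M + N) <= vnorm M + vnorm N.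
Proof.
apply: vnorm_le_sqr; first by rewrite addr_ge0 ?vnorm_ge0.
have CS := @Cauchy_Schwarz_sum _ (fun p : 'I_m * 'I_n => normc (M p.1 p.2))
             (fun p => normc (N p.1 p.2)).
rewrite -!vnorm_sqr -exprMn in CS.
have {}CS : \sum_(p : 'I_m * 'I_n) normc (M p.1 p.2) * normc (N p.1 p.2)
    <= vnorm M * vnorm N.
  rewrite -ler_sqr ?nnegrE ?mulr_ge0 ?vnorm_ge0 //.
  by apply: sumr_ge0 => p _; rewrite mulr_ge0 ?normc_ge0.
rewrite sqrrD vnorm_sqr (vnorm_sqr M) (vnorm_sqr N).
apply: (@le_trans _ _ (\sum_(p : 'I_m * 'I_n) (normc (M p.1 p.2) ^+ 2
    + normc (M p.1 p.2) * normc (N p.1 p.2) *+ 2 + normc (N p.1 p.2) ^+ 2))).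
  apply: ler_sum => p _; rewrite mxE -sqrrD.
  by rewrite ler_sqr ?nnegrE ?addr_ge0 ?normc_ge0 ?le_normcD.
rewrite big_split big_split /= sumrMnl.
by rewrite lerD2r lerD2l lerMn2r.
Qed.

Lemma vnorm0 (m n : nat) : vnorm (0 : 'M[C]_(m, n)) = 0.
Proof.
rewrite vnorm_normc big1 ?sqrtr0 // => p _.
by rewrite mxE ComplexField.Normc.normc0 expr0n.
Qed.

Lemma vnormN (m n : nat) (M : 'M[C]_(m, n)) : vnorm (- M) = vnorm M.
Proof.
by rewrite !vnorm_normc; congr Num.sqrt; apply: eq_bigr => p _; rewrite mxE normcN.
Qed.

Lemma vnormB (m n : nat) (M N : 'M[C]_(m, n)) : vnorm (M - N) = vnorm (N - M).
Proof. by rewrite -vnormN opprB. Qed.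

Lemma ler_vnormB (m n : nat) (M N : 'M[C]_(m, n)) :
  vnorm (M - N) <= vnorm M + vnorm N.
Proof. by rewrite -(vnormN N) ler_vnormD. Qed.

Lemma vnorm_split (m n : nat) (P M N : 'M[C]_(m, n)) :
  vnorm (M - N) <= vnorm (M - P) + vnorm (P - N).
Proof. by rewrite (_ : M - N = (M - P) + (P - N)) ?ler_vnormD // addrA subrK. Qed.

Lemma ler_vnorm_sum (m n : nat) (I : Type) (r : seq I) (F : I -> 'M[C]_(m, n)) :
  vnorm (\sum_(i <- r) F i) <= \sum_(i <- r) vnorm (F i).
Proof.
elim/big_ind2: _ => [|x1 x2 y1 y2 h1 h2|//]; first by rewrite vnorm0.
exact: le_trans (ler_vnormD _ _) (lerD _ _).
Qed.

Lemma normc_sum (I : Type) (r : seq I) (F : I -> C) :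
  normc (\sum_(i <- r) F i) <= \sum_(i <- r) normc (F i).
Proof.
elim/big_ind2: _ => [|x1 x2 y1 y2 h1 h2|//]; first by rewrite ComplexField.Normc.normc0.
exact: le_trans (le_normcD _ _) (lerD _ _).
Qed.

Lemma ler_vnormM (m n p : nat) (M : 'M[C]_(m, n)) (N : 'M[C]_(n, p)) :
  vnorm (M *m N) <= vnorm M * vnorm N.
Proof.
apply: vnorm_le_sqr; first by rewrite mulr_ge0 ?vnorm_ge0.
rewrite exprMn !vnorm_sqr -!(pair_bigA _ (fun i j => normc (_ i j) ^+ 2)) /=.
rewrite [X in _ * X]exchange_big big_distrl /=; apply: ler_sum => i _.
rewrite big_distrr /=; apply: ler_sum => j _.
apply: le_trans (Cauchy_Schwarz_sum _ _).
rewrite ler_sqr ?nnegrE ?normc_ge0 //; last first.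
  by apply: sumr_ge0 => k _; rewrite mulr_ge0 ?normc_ge0.
rewrite mxE; apply: le_trans (normc_sum _ _) _.
by apply: ler_sum => k _; rewrite ComplexField.Normc.normcM.
Qed.

Lemma vnorm_eq0 (m n : nat) (M : 'M[C]_(m, n)) : vnorm M = 0 -> M = 0.
Proof.
move=> M0; have := vnorm_sqr M; rewrite M0 expr0n /= => /esym/eqP.
rewrite psumr_eq0 => [/allP h|p _]; last exact: sqr_ge0.
apply/matrixP => i j; rewrite mxE.
have := h (i, j); rewrite mem_index_enum sqrf_eq0 /= => /(_ isT)/eqP.
exact: ComplexField.Normc.eq0_normc.
Qed.

Lemma normc_le_vnorm (m n : nat) (M : 'M[C]_(m, n)) i j : normc (M i j) <= vnorm M.
Proof.
rewrite -ler_sqr ?nnegrE ?normc_ge0 ?vnorm_ge0 // vnorm_sqr (bigD1 (i, j)) //=.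
by rewrite lerDl; apply: sumr_ge0 => p _; exact: sqr_ge0.
Qed.

Lemma normr_Re_vnorm (m n : nat) (M : 'M[C]_(m, n)) i j :
  `|complex.Re (M i j)| <= vnorm M.
Proof.
apply: le_trans (normc_le_vnorm M i j).
rewrite -ler_sqr ?nnegrE ?normc_ge0 ?normr_ge0 // normcE2 real_normK ?num_real //.
by rewrite lerDl sqr_ge0.
Qed.

Lemma normr_Im_vnorm (m n : nat) (M : 'M[C]_(m, n)) i j :
  `|complex.Im (M i j)| <= vnorm M.
Proof.
apply: le_trans (normc_le_vnorm M i j).
rewrite -ler_sqr ?nnegrE ?normc_ge0 ?normr_ge0 // normcE2 real_normK ?num_real //.
by rewrite lerDr sqr_ge0.
Qed.

(** The square root of [2 * m * n] would do; the cruder natural number is harmless, since it is used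
    only with an arbitrarily small [x] or inside constants whose size does not matter. *)
Lemma vnorm_le_entries (m n : nat) (M : 'M[C]_(m, n)) (x : R) :
  (forall i j, `|complex.Re (M i j)| <= x /\ `|complex.Im (M i j)| <= x) ->
  vnorm M <= (2 * m * n)%:R * x.
Proof.
(* A negative [x] is possible only for a matrix without entries, and then both sides vanish. *)
move=> Mx; have [x0|x0] := lerP 0 x; last first.
  rewrite (_ : M = 0); last first.
    apply/matrixP => i j; have [h _] := Mx i j.
    by have := le_lt_trans h x0; rewrite normr_lt0.
  suff : (m * n = 0)%N by rewrite vnorm0 -mulnA => ->; rewrite muln0 mul0r.
  case: m M Mx => // m M; case: n M => [|n] M Mx; first by rewrite muln0.
  by have [h _] := Mx ord0 ord0; have := le_lt_trans h x0; rewrite normr_lt0.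
apply: vnorm_le_sqr; first by rewrite mulr_ge0.
rewrite vnorm_sqr.
apply: (@le_trans _ _ (\sum_(p : 'I_m * 'I_n) 2 * x ^+ 2)).
  apply: ler_sum => p _; have [h1 h2] := Mx p.1 p.2; rewrite normcE2.
  rewrite mulr_natl mulr2n -(real_normK (num_real (complex.Re _))).
  rewrite -(real_normK (num_real (complex.Im _))).
  by apply: lerD; rewrite ler_sqr ?nnegrE.
rewrite sumr_const card_prod !card_ord -[_ *+ (m * n)]mulr_natl mulrA exprMn.
rewrite -natrM -natrX.
rewrite ler_wpM2r ?sqr_ge0 // ler_nat; nia.
Qed.

End EuclideanNorm.

(** * Continuous matrix functions *)

Section Continuity.
Variable R : realType.
Local Notation C := (R[i]).

Lemma mx_continuousP (m n : nat) (F : R -> 'M[C]_(m, n)) :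
  mx_continuous F <-> forall t, vnorm (F s - F t) @[s --> t] --> (0 : R).
Proof.
split=> [cF t|cF t e e0].
  apply/cvgrPdist_lt => e e0; have [d d0 Fd] := cF t _ e0.
  near=> s; rewrite sub0r normrN ger0_norm ?vnorm_ge0 //; apply: Fd.
  by rewrite distrC; near: s; exact: (@cvgr_dist_lt _ _ _ _ (nbhs_filter t) id).
have /cvgrPdist_lt/(_ _ e0) := cF t.
move=> /nbhs_ballP[d /= d0 Fd]; exists d => // s st.
have := Fd s; rewrite /ball /= distrC => /(_ st).
by rewrite sub0r normrN ger0_norm ?vnorm_ge0.
Unshelve. all: by end_near. Qed.

Lemma mx_continuous_cst (m n : nat) (M : 'M[C]_(m, n)) : mx_continuous (fun=> M).
Proof. by move=> t e e0; exists 1 => // s _; rewrite subrr vnorm0. Qed.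

Lemma mx_continuous_shift (m n : nat) (F : R -> 'M[C]_(m, n)) (tau : R) :
  mx_continuous F -> mx_continuous (fun t => F (t + tau)).
Proof.
move=> cF t e e0; have [d d0 Fd] := cF (t + tau) _ e0; exists d => // s st.
by apply: Fd; rewrite (_ : _ - _ = s - t) //; lra.
Qed.

Lemma mx_continuous_vnorm (m n : nat) (F : R -> 'M[C]_(m, n)) :
  mx_continuous F -> continuous (fun t => vnorm (F t)).
Proof.
move=> cF t; apply/cvgrPdist_lt => e e0; have [d d0 Fd] := cF t _ e0.
near=> s.
have Fst : vnorm (F s - F t) < e.
  apply: Fd; rewrite distrC; near: s.
  exact: (@cvgr_dist_lt _ _ _ _ (nbhs_filter t) id).
have h1 := ler_vnormD (F s - F t) (F t); have h2 := ler_vnormD (F t - F s) (F s).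
rewrite !subrK (vnormB (F t)) in h1 h2.
by rewrite ltr_norml; lra.
Unshelve. all: by end_near. Qed.

Lemma mx_continuous_Re (m n : nat) (F : R -> 'M[C]_(m, n)) i j :
  mx_continuous F -> continuous (fun t => complex.Re (F t i j)).
Proof.
move=> cF t; apply/cvgrPdist_lt => e e0; have [d d0 Fd] := cF t _ e0.
near=> s; apply: le_lt_trans (Fd s _); last first.
  by rewrite distrC; near: s; exact: (@cvgr_dist_lt _ _ _ _ (nbhs_filter t) id).
by rewrite distrC; have := normr_Re_vnorm (F s - F t) i j; rewrite !mxE raddfB.
Unshelve. all: by end_near. Qed.

Lemma mx_continuous_Im (m n : nat) (F : R -> 'M[C]_(m, n)) i j :
  mx_continuous F -> continuous (fun t => complex.Im (F t i j)).
Proof.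
move=> cF t; apply/cvgrPdist_lt => e e0; have [d d0 Fd] := cF t _ e0.
near=> s; apply: le_lt_trans (Fd s _); last first.
  by rewrite distrC; near: s; exact: (@cvgr_dist_lt _ _ _ _ (nbhs_filter t) id).
by rewrite distrC; have := normr_Im_vnorm (F s - F t) i j; rewrite !mxE raddfB.
Unshelve. all: by end_near. Qed.

Lemma mx_continuousD (m n : nat) (F G : R -> 'M[C]_(m, n)) :
  mx_continuous F -> mx_continuous G -> mx_continuous (fun t => F t + G t).
Proof.
move=> cF cG t e e0; have e20 : 0 < e / 2 by rewrite divr_gt0.
have [d d0 Fd] := cF t _ e20; have [d' d'0 Gd] := cG t _ e20.
exists (Num.min d d'); first by rewrite lt_min d0.
move=> s; rewrite lt_min => /andP[/Fd h1 /Gd h2].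
rewrite opprD addrACA; apply: le_lt_trans (ler_vnormD _ _) _; lra.
Qed.

Lemma mx_continuousN (m n : nat) (F : R -> 'M[C]_(m, n)) :
  mx_continuous F -> mx_continuous (fun t => - F t).
Proof.
move=> cF t e e0; have [d d0 Fd] := cF t _ e0; exists d => // s /Fd.
by rewrite -opprD vnormN.
Qed.

Lemma mx_continuousM (m n p : nat) (F : R -> 'M[C]_(m, n)) (G : R -> 'M[C]_(n, p)) :
  mx_continuous F -> mx_continuous G -> mx_continuous (fun t => F t *m G t).
Proof.
move=> /mx_continuousP cF cG; apply/mx_continuousP => t.
have cGt : vnorm (G s) @[s --> t] --> vnorm (G t) by exact: mx_continuous_vnorm.
move/mx_continuousP : cG => cG.
apply: (@squeeze_cvgr _ _ _ _ (fun=> 0)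
  (fun s => vnorm (F s - F t) * vnorm (G s) + vnorm (F t) * vnorm (G s - G t))).
- near=> s; rewrite vnorm_ge0 /=.
  rewrite (_ : _ - _ = (F s - F t) *m G s + F t *m (G s - G t)); last first.
    by rewrite mulmxBl mulmxBr addrA subrK.
  exact: le_trans (ler_vnormD _ _) (lerD (ler_vnormM _ _) (ler_vnormM _ _)).
- exact: cvg_cst.
- have := cvgD (cvgM (cF t) cGt) (cvgM (cvg_cst (vnorm (F t))) (cG t)).
  by rewrite mul0r mulr0 addr0; exact.
Unshelve. all: by end_near. Qed.

(** The identity for a difference of inverses leaves the unknown norm of [invmx (F s)] on the right.
    Once [vnorm (F s - F t) * w < 1 / 2], it can be absorbed, which bounds that norm by [2 * w]. *)
Lemma mx_continuousV (q : nat) (F : R -> 'M[C]_q) : (forall t, F t \in unitmx) ->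
  mx_continuous F -> mx_continuous (fun t => invmx (F t)).
Proof.
move=> uF /mx_continuousP cF; apply/mx_continuousP => t.
set w := vnorm (invmx (F t)); have w0 : 0 <= w := vnorm_ge0 _.
have Fst s : vnorm (invmx (F s) - invmx (F t)) <=
    vnorm (invmx (F s)) * (vnorm (F s - F t) * w).
  rewrite (_ : _ - _ = invmx (F s) *m (F t - F s) *m invmx (F t)); last first.
    by rewrite mulmxBr mulVmx // mulmxBl mul1mx -mulmxA mulmxV // mulmx1.
  rewrite -mulmxA; apply: le_trans (ler_vnormM _ _) _.
  by rewrite ler_wpM2l ?vnorm_ge0 // (vnormB (F s)) ler_vnormM.
have cw : vnorm (F s - F t) * w @[s --> t] --> 0.
  by have := cvgM (cF t) (cvg_cst w); rewrite mul0r; exact.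
apply: (@squeeze_cvgr _ _ _ _ (fun=> 0)
  (fun s => (2 * w) * (vnorm (F s - F t) * w))).
- near=> s; rewrite vnorm_ge0 /=; apply: le_trans (Fst s) _.
  rewrite ler_wpM2r ?mulr_ge0 ?vnorm_ge0 //.
  have small : vnorm (F s - F t) * w < 1 / 2.
    near: s; move/cvgrPdist_lt : cw => /(_ (1 / 2)).
    rewrite divr_gt0 // => /(_ isT); apply: filterS => s.
    by rewrite sub0r normrN ger0_norm ?mulr_ge0 ?vnorm_ge0.
  have := ler_vnormD (invmx (F s) - invmx (F t)) (invmx (F t)).
  rewrite subrK -/w; have := Fst s; have := vnorm_ge0 (invmx (F s)).
  by nra.
- exact: cvg_cst.
- by have := cvgM (cvg_cst (2 * w)) cw; rewrite mulr0; exact.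
Unshelve. all: by end_near. Qed.

Lemma mx_continuous_bounded (m n : nat) (F : R -> 'M[C]_(m, n)) (a b : R) :
  mx_continuous F -> exists2 M : R, 0 <= M &
    forall t, a <= t <= b -> vnorm (F t) <= M.
Proof.
move=> cF; have [ab|ba] := lerP a b; last first.
  by exists 0 => // t /andP[h1 h2]; have := le_lt_trans (le_trans h1 h2) ba; rewrite ltxx.
have [c _ Fc] := EVT_max ab (continuous_subspaceT (mx_continuous_vnorm cF)).
by exists (vnorm (F c)); [exact: vnorm_ge0|move=> t ?; apply: Fc; rewrite in_itv].
Qed.

(** Only [t] is confined to the segment. The point [s] may lie outside, as happens when two nearby
    points are translated so that one of them falls in a given window. *)
Lemma mx_continuous_Heine (m n : nat) (F : R -> 'M[C]_(m, n)) (a b e : R) :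
  mx_continuous F -> 0 < e -> exists2 d : R, 0 < d &
    forall s t, a <= t <= b -> `|s - t| < d -> vnorm (F s - F t) < e.
Proof.
move=> cF e0.
have e20 : 0 < e / 2 by rewrite divr_gt0.
(* The radius runs along the filter of right neighbourhoods of 0, so compactness produces a radius
   valid for all [t] at once. *)
have /compact_near_coveringP/(_ R (0^'+) (fun d t => forall s, `|s - t| < d ->
  vnorm (F s - F t) < e)) := @segment_compact R a b.
case=> [x _|d /= d0 H].
  have [d d0 Fd] := cF x _ e20; have d20 : 0 < d / 2 by rewrite divr_gt0.
  exists ([set t | `|t - x| < d / 2], [set r | r < d / 2]) => /=.
    split; last exact: nbhs_right_lt.
    by apply/nbhs_ballP; exists (d / 2) => //= y; rewrite /ball /= distrC.
  move=> [t r] /= [tx rd] s st; have := Fd t _; have := Fd s _.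
  have h := ler_distD t s x.
  move=> /(_ ltac:(lra)) h1 /(_ ltac:(lra)) h2.
  apply: le_lt_trans (vnorm_split (F x) _ _) _; rewrite (vnormB (F x)); lra.
exists (d / 2); first by rewrite divr_gt0.
have := H (d / 2); rewrite /ball /= sub0r normrN gtr0_norm ?divr_gt0 //.
move=> /(_ ltac:(lra) ltac:(lra)) K s t tab; exact: K.
Qed.

End Continuity.

(** * Integrals *)

Section Integral.
Variable R : realType.
Local Notation C := (R[i]).
Local Notation mu := (@lebesgue_measure R).

Lemma continuous_integrable (g : R -> R) (a b : R) :
  continuous g -> mu.-integrable `[a, b] (EFin \o g).
Proof.
move=> cg; apply: continuous_compact_integrable; first exact: segment_compact.
exact: continuous_subspaceT.
Qed.

Lemma Rintegral_itv_cat (g : R -> R) (a b c : R) : continuous g -> a <= b -> b <= c ->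
  Rintegral mu `[a, c] g = Rintegral mu `[a, b] g + Rintegral mu `[b, c] g.
Proof.
move=> cg ab bc.
have := @Rintegral_itvB R g (BLeft a) (BRight c) b (continuous_integrable _ _ cg).
rewrite !bnd_simp => /(_ ab bc); rewrite Rintegral_itv_obnd_cbnd => [<-|].
  by rewrite addrC subrK.
apply: (integrableS _ _ _ (continuous_integrable b c cg)) => //.
by apply: subset_itvr; rewrite bnd_simp.
Qed.

Lemma Rintegral_shift (g : R -> R) (a b tau : R) : continuous g -> a <= b ->
  Rintegral mu `[a + tau, b + tau] g = Rintegral mu `[a, b] (fun t => g (t + tau)).
Proof.
move=> cg ab; rewrite /Rintegral; congr fine.
have D : derive1 (shift tau : R -> R) = cst 1.
  by apply/funext => z; rewrite derive1E deriveD // derive_id derive_cst addr0.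
rewrite (@integration_by_substitution_increasing _ (shift tau)) //.
- by apply: eq_integral => x _; rewrite !fctE D /= mulr1.
- by move=> x y _ _; rewrite ltrD2r.
- by rewrite D => x _; exact: cst_continuous.
- by rewrite D; exact: is_cvg_cst.
- by rewrite D; exact: is_cvg_cst.
- have cs : continuous (fun t : R => t + tau).
    by move=> x; apply: cvgD; [exact: cvg_id|exact: cvg_cst].
  split; first by move=> x _; exact: ex_derive.
  + by apply: cvg_at_right_filter; exact: cs.
  + by apply: cvg_at_left_filter; exact: cs.
- exact: continuous_subspaceT.
Qed.

Lemma normr_Rintegral_le (g : R -> R) (a b x : R) : continuous g -> a <= b ->
  (forall t, a <= t <= b -> `|g t| <= x) -> `|Rintegral mu `[a, b] g| <= (b - a) * x.
Proof.
move=> cg ab gx; apply: le_trans (le_normr_Rintegral _ (continuous_integrable a b cg)) _.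
  by [].
have cng : continuous (fun t => `|g t|).
  by move=> t; apply: cvg_norm; exact: cg.
have ccst : continuous (fun _ : R => x) by move=> t; exact: cst_continuous.
apply: (@le_trans _ _ (Rintegral mu `[a, b] (fun=> x))).
  apply: le_Rintegral => //.
  - exact: continuous_integrable.
  - exact: (continuous_integrable a b ccst).
rewrite Rintegral_cst //= lebesgue_measure_itv /= lte_fin.
have [|ba] := ltP a b; first by rewrite -EFinD /= mulrC.
by rewrite (_ : b = a) ?subrr ?mul0r ?mulr0 //; apply/eqP; rewrite eq_le ba.
Qed.

Definition cintegral (a b : R) (g : R -> C) : C :=
  Complex (Rintegral mu `[a, b] (fun u => complex.Re (g u)))
          (Rintegral mu `[a, b] (fun u => complex.Im (g u))).

Definition ccontinuous (g : R -> C) :=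
  continuous (fun t => complex.Re (g t)) /\ continuous (fun t => complex.Im (g t)).

Lemma ccontinuousD (g h : R -> C) : ccontinuous g -> ccontinuous h ->
  ccontinuous (fun t => g t + h t).
Proof.
move=> [g1 g2] [h1 h2]; split=> t.
  under eq_fun do rewrite raddfD.
  by apply: cvgD; [exact: g1|exact: h1].
under eq_fun do rewrite raddfD.
by apply: cvgD; [exact: g2|exact: h2].
Qed.

Lemma ReM (x y : C) : complex.Re (x * y) =
  complex.Re x * complex.Re y - complex.Im x * complex.Im y.
Proof. by case: x y => [? ?] [? ?]. Qed.

Lemma ImM (x y : C) : complex.Im (x * y) =
  complex.Re x * complex.Im y + complex.Im x * complex.Re y.
Proof. by case: x y => [? ?] [? ?]. Qed.

Lemma continuousZ (k : R) (g : R -> R) : continuous g -> continuous (fun t => k * g t).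
Proof. by move=> cg t; apply: cvgM; [exact: cvg_cst|exact: cg]. Qed.

Lemma ccontinuousZ (k : C) (g : R -> C) : ccontinuous g -> ccontinuous (fun t => k * g t).
Proof.
move=> [g1 g2]; split=> t.
  under eq_fun do rewrite ReM.
  by apply: cvgB; apply: continuousZ.
under eq_fun do rewrite ImM.
by apply: cvgD; apply: continuousZ.
Qed.

Lemma cintegralD (a b : R) (g h : R -> C) : ccontinuous g -> ccontinuous h ->
  cintegral a b (fun t => g t + h t) = cintegral a b g + cintegral a b h.
Proof.
move=> [g1 g2] [h1 h2]; rewrite /cintegral.
under eq_Rintegral do rewrite raddfD.
rewrite RintegralD //; [|exact: continuous_integrable..].
under [X in Complex _ X]eq_Rintegral do rewrite raddfD.
by rewrite RintegralD //; exact: continuous_integrable.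
Qed.

Lemma cintegralZ (a b : R) (k : C) (g : R -> C) : ccontinuous g ->
  cintegral a b (fun t => k * g t) = k * cintegral a b g.
Proof.
move=> [g1 g2]; rewrite /cintegral.
under eq_Rintegral do rewrite ReM.
rewrite RintegralB //; [|exact/continuous_integrable/continuousZ..].
under [X in Complex _ X]eq_Rintegral do rewrite ImM.
rewrite RintegralD //; [|exact/continuous_integrable/continuousZ..].
rewrite !RintegralZl //; [|exact: continuous_integrable..].
by case: k => x y.
Qed.

Lemma ccontinuous0 : ccontinuous (fun=> 0).
Proof. by split=> t; exact: cst_continuous. Qed.

Lemma ccontinuous_sum (I : Type) (r : seq I) (g : I -> R -> C) :
  (forall i, ccontinuous (g i)) -> ccontinuous (fun t => \sum_(i <- r) g i t).
Proof.
move=> cg; elim: r => [|i r IH].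
  by rewrite (_ : (fun _ => _) = fun=> 0); [exact: ccontinuous0|apply/funext => t; rewrite big_nil].
rewrite (_ : (fun _ => _) = fun t => g i t + \sum_(j <- r) g j t).
  exact: ccontinuousD.
by apply/funext => t; rewrite big_cons.
Qed.

Lemma cintegral_sum (I : Type) (r : seq I) (a b : R) (g : I -> R -> C) :
  (forall i, ccontinuous (g i)) ->
  cintegral a b (fun t => \sum_(i <- r) g i t) = \sum_(i <- r) cintegral a b (g i).
Proof.
move=> cg; elim: r => [|i r IH].
  (* Writing zero as [0 * 0] lets homogeneity compute its integral. *)
  rewrite big_nil (_ : (fun _ => _) = fun t => 0 * 0); last first.
    by apply/funext => t; rewrite big_nil mulr0.
  by rewrite cintegralZ ?mul0r //; exact: ccontinuous0.
rewrite big_cons -IH -cintegralD //; last exact: ccontinuous_sum.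
by congr cintegral; apply/funext => t; rewrite big_cons.
Qed.

Lemma mx_ccontinuous (m n : nat) (F : R -> 'M[C]_(m, n)) i j :
  mx_continuous F -> ccontinuous (fun t => F t i j).
Proof. by move=> cF; split; [exact: mx_continuous_Re|exact: mx_continuous_Im]. Qed.

Lemma cintE (m n : nat) (a b : R) (F : R -> 'M[C]_(m, n)) i j :
  cint a b F i j = cintegral a b (fun t => F t i j).
Proof. by rewrite mxE. Qed.

Lemma eq_cint (m n : nat) (a b : R) (F G : R -> 'M[C]_(m, n)) :
  (forall t, a <= t <= b -> F t = G t) -> cint a b F = cint a b G.
Proof.
move=> FG; apply/matrixP => i j; rewrite !mxE.
by congr Complex; apply: eq_Rintegral => t; rewrite inE /= in_itv /= => /FG ->.
Qed.

Lemma cintD (m n : nat) (a b : R) (F G : R -> 'M[C]_(m, n)) :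
  mx_continuous F -> mx_continuous G ->
  cint a b (fun t => F t + G t) = cint a b F + cint a b G.
Proof.
move=> cF cG; apply/matrixP => i j; rewrite [RHS]mxE !cintE.
rewrite -cintegralD; [|exact: mx_ccontinuous..].
by congr cintegral; apply/funext => t; rewrite mxE.
Qed.

Lemma cintB (m n : nat) (a b : R) (F G : R -> 'M[C]_(m, n)) :
  mx_continuous F -> mx_continuous G ->
  cint a b (fun t => F t - G t) = cint a b F - cint a b G.
Proof.
move=> cF cG; have cN := mx_continuousN cG; rewrite cintD //; congr (_ + _).
apply/matrixP => i j; rewrite [RHS]mxE !cintE -mulN1r -cintegralZ; last exact: mx_ccontinuous.
by congr cintegral; apply/funext => t; rewrite mxE mulN1r.
Qed.

Lemma cint_mulmxl (m n p : nat) (a b : R) (M : 'M[C]_(m, n)) (F : R -> 'M[C]_(n, p)) :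
  mx_continuous F -> cint a b (fun t => M *m F t) = M *m cint a b F.
Proof.
move=> cF; apply/matrixP => i j; rewrite [RHS]mxE cintE.
rewrite (eq_bigr (fun k => cintegral a b (fun t => M i k * F t k j))); last first.
  by move=> k _; rewrite cintE cintegralZ //; exact: mx_ccontinuous.
rewrite -cintegral_sum; last by move=> k; apply/ccontinuousZ/mx_ccontinuous.
by congr cintegral; apply/funext => t; rewrite mxE.
Qed.

Lemma cint_mulmxr (m n p : nat) (a b : R) (M : 'M[C]_(n, p)) (F : R -> 'M[C]_(m, n)) :
  mx_continuous F -> cint a b (fun t => F t *m M) = cint a b F *m M.
Proof.
move=> cF; apply/matrixP => i j; rewrite [RHS]mxE cintE.
rewrite (eq_bigr (fun k => cintegral a b (fun t => M k j * F t i k))); last first.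
  by move=> k _; rewrite cintE mulrC cintegralZ //; exact: mx_ccontinuous.
rewrite -cintegral_sum; last by move=> k; apply/ccontinuousZ/mx_ccontinuous.
by congr cintegral; apply/funext => t; rewrite mxE; apply: eq_bigr => k _; rewrite mulrC.
Qed.

Lemma cint_cat (m n : nat) (a b c : R) (F : R -> 'M[C]_(m, n)) :
  mx_continuous F -> a <= b -> b <= c -> cint a c F = cint a b F + cint b c F.
Proof.
move=> cF ab bc; apply/matrixP => i j; rewrite !mxE; apply/eqP.
rewrite eq_complex /= -!Rintegral_itv_cat ?eqxx //.
  exact: mx_continuous_Im.
exact: mx_continuous_Re.
Qed.

Lemma cint_shift (m n : nat) (a b tau : R) (F : R -> 'M[C]_(m, n)) :
  mx_continuous F -> a <= b ->
  cint (a + tau) (b + tau) F = cint a b (fun t => F (t + tau)).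
Proof.
move=> cF ab; apply/matrixP => i j; rewrite !mxE; congr Complex.
  by rewrite Rintegral_shift //; exact: mx_continuous_Re.
by rewrite Rintegral_shift //; exact: mx_continuous_Im.
Qed.

Definition cint_cst (m n : nat) : R := (2 * m * n)%:R.

Lemma cint_cst_ge0 (m n : nat) : 0 <= cint_cst m n.
Proof. exact: ler0n. Qed.

Lemma vnorm_cint (m n : nat) (a b x : R) (F : R -> 'M[C]_(m, n)) :
  mx_continuous F -> a <= b -> (forall t, a <= t <= b -> vnorm (F t) <= x) ->
  vnorm (cint a b F) <= cint_cst m n * ((b - a) * x).
Proof.
move=> cF ab Fx; apply: vnorm_le_entries => i j; rewrite mxE /=; split.
  apply: normr_Rintegral_le => // [|t /Fx]; first exact: mx_continuous_Re.
  exact: le_trans (normr_Re_vnorm _ _ _).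
apply: normr_Rintegral_le => // [|t /Fx]; first exact: mx_continuous_Im.
exact: le_trans (normr_Im_vnorm _ _ _).
Qed.

End Integral.

(** * Finite colourings and almost periodicity *)

Section FiniteColouring.
Variable R : realType.
Local Notation C := (R[i]).

(** Total boundedness in combinatorial form: when [D s s'] says that the translates by [s] and [s']
    are close, this is Bochner's description of almost periodicity. Unlike relative density, it is
    stable under conjunction and under reparametrisation. *)
Definition finitely_colourable (S : Type) (D : S -> S -> Prop) : Prop :=
  exists (K : finType) (c : S -> K), forall s s', c s = c s' -> D s s'.

Lemma colourable_cover (S : Type) (K : finType) (P : S -> K -> Prop)
    (D : S -> S -> Prop) : (forall s, exists k, P s k) ->
  (forall s s' k, P s k -> P s' k -> D s s') -> finitely_colourable D.
Proof.
move=> /choice[c Pc] PD; exists K, c => s s' cs.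
by apply: (PD _ _ (c s)); rewrite // cs.
Qed.

Lemma colourable_sub (S : Type) (D D' : S -> S -> Prop) :
  (forall s s', D s s' -> D' s s') ->
  finitely_colourable D -> finitely_colourable D'.
Proof. by move=> DD' [K [c Dc]]; exists K, c => s s' /Dc/DD'. Qed.

Lemma colourable_and (S : Type) (D D' : S -> S -> Prop) :
  finitely_colourable D -> finitely_colourable D' ->
  finitely_colourable (fun s s' => D s s' /\ D' s s').
Proof.
move=> [K [c Dc]] [K' [c' Dc']].
exists (K * K')%type, (fun s => (c s, c' s)) => s s' [/Dc ? /Dc' ?]; by split.
Qed.

Lemma colourable_comp (S S' : Type) (f : S -> S') (D : S' -> S' -> Prop) :
  finitely_colourable D -> finitely_colourable (fun s s' => D (f s) (f s')).
Proof. by move=> [K [c Dc]]; exists K, (c \o f) => s s' /= /Dc. Qed.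

(** Subtracting from an integer the fixed representative of its colour gives an element of [E], and
    the finitely many representatives are bounded by [M]. *)
Lemma colourable_reldense (E : set int) :
  finitely_colourable (fun a b => E (b - a)) -> reldense_Z R E.
Proof.
move=> [K [c cE]].
have /choice[rep repP] : forall k : K, exists a : int, (exists b, c b = k) -> c a = k.
  move=> k; have [[b bk]|nb] := pselect (exists b, c b = k); first by exists b.
  by exists 0 => /nb.
pose M := (\sum_k `|rep k|)%N.
have repM k : (`|rep k| <= M)%N by rewrite /M (bigD1 k) //= leq_addr.
exists (2 * M%:R + 1); first by rewrite ltr_wpDl // mulr_ge0.
(* The offset [M] makes [p - rep (c p)] at least the ceiling of [m]. It exceeds that ceiling by at
   most [2 * M], and rounding costs the remaining 1 in the length. *)
move=> m; pose p := Num.ceil m + M%:Z; exists (p - rep (c p)).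
  by apply: cE; apply: repP; exists p.
have /andP[c1 c2] := ceil_itv m.
have := repM (c p).
have : (Num.ceil m : int)%:~R - 1 < m by move: c1; rewrite intrD mulrN1z.
have -> : (p - rep (c p))%:~R = (Num.ceil m)%:~R + (M%:R - (rep (c p))%:~R) :> R.
  by rewrite /p intrB intrD -pmulrn addrA.
move=> h1 h2.
have : - M%:Z <= rep (c p) <= M%:Z by lia.
rewrite -!(ler_int R) mulrNz -pmulrn.
by move: c2 => /= c2 /andP[h3 h4]; apply/andP; split; lra.
Qed.

(** The window of length [l] ending at [m] meets [E], at an integer distance from [m] below [N]. So
    finitely many translates of [E] cover all the integers. *)
Lemma reldense_cover (E : set int) : reldense_Z R E ->
  exists N : nat, forall m : int, exists r : 'I_N, E (m - r%:Z).
Proof.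
move=> [l l0 El]; exists (Num.truncn l).+1 => m.
have [T ET /andP[mT Tm]] := El (m%:~R - l).
rewrite subrK in Tm; rewrite ler_int in Tm.
have [d dE] : exists d : nat, m - T = d%:Z by exists `|m - T|%N; lia.
have dl : (d < (Num.truncn l).+1)%N.
  rewrite ltnS (truncn_ge_nat _ (ltW l0)) (_ : d%:R = (m - T)%:~R).
    by rewrite intrB; lra.
  by rewrite dE -pmulrn.
by exists (Ordinal dl); rewrite /= -dE subKr.
Qed.

Lemma almost_periodic_Z_bounded (m n : nat) (g : int -> 'M[C]_(m, n)) :
  almost_periodic_Z g -> exists2 M : R, 0 <= M & forall k, vnorm (g k) <= M.
Proof.
move=> /(_ 1 ltr01)/reldense_cover[N EN].
exists (1 + \sum_(r < N) vnorm (g r%:Z)).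
  by rewrite addr_ge0 // sumr_ge0 // => r _; exact: vnorm_ge0.
move=> k; have [r /(_ r%:Z)] := EN k.
rewrite [r%:Z + _]addrC subrK => h; have := ler_vnormD (g k - g r%:Z) (g r%:Z).
rewrite subrK => /le_trans; apply; apply: lerD => //.
rewrite (bigD1 r) //= lerDl; apply: sumr_ge0 => i _; exact: vnorm_ge0.
Qed.

Definition mx_unif_continuous (m n : nat) (F : R -> 'M[C]_(m, n)) : Prop :=
  forall e : R, 0 < e -> exists2 d : R, 0 < d &
    forall s t : R, `|s - t| <= d -> vnorm (F s - F t) <= e.

Lemma mx_unif_continuousW (m n : nat) (F : R -> 'M[C]_(m, n)) :
  mx_unif_continuous F -> mx_continuous F.
Proof.
move=> uF t e e0; have [|d d0 Fd] := uF (e / 2); first by rewrite divr_gt0.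
exists d => // s /ltW/Fd; lra.
Qed.

Lemma almost_periodic_unif_continuous (m n : nat) (g : R -> 'M[C]_(m, n)) :
  almost_periodic_R g -> mx_unif_continuous g.
Proof.
move=> [cg apg] e e0; have e30 : 0 < e / 3 by rewrite divr_gt0.
have [l l0 gl] := apg _ e30.
have [d d0 gd] := mx_continuous_Heine 0 l cg e30.
exists (d / 2); first by rewrite divr_gt0.
move=> s t st; have [tau gtau /andP[h1 h2]] := gl (- t).
have h3 : vnorm (g (s + tau) - g (t + tau)) < e / 3.
  apply: gd; first by apply/andP; split; lra.
  by rewrite (_ : _ - _ = s - t); lra.
have h4 := gtau s; have h5 := gtau t; rewrite vnormB in h4.
have h6 := vnorm_split (g (s + tau)) (g s) (g t).
have h7 := vnorm_split (g (t + tau)) (g (s + tau)) (g t).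
lra.
Qed.

Lemma almost_periodic_R_bounded (m n : nat) (g : R -> 'M[C]_(m, n)) :
  almost_periodic_R g -> exists2 M : R, 0 < M & forall t, vnorm (g t) <= M.
Proof.
move=> [cg apg]; have [l l0 gl] := apg 1 ltr01.
have [M M0 gM] := mx_continuous_bounded 0 l cg.
exists (M + 1) => [|t]; first by rewrite ltr_wpDl.
have [tau /(_ t) gtau /andP[h1 h2]] := gl (- t).
have := gM (t + tau); have := ler_vnormD (g t - g (t + tau)) (g (t + tau)).
rewrite subrK vnormB => h3 /(_ ltac:(apply/andP; split; lra)); lra.
Qed.

(** An almost period [tau] in [[s - l, s]] replaces the translate by [s] with the one by [s - tau],
    which lies in [[0, l]]. Uniform continuity then rounds it down to a multiple of [d], and this
    multiple is the colour. *)
Lemma almost_periodic_R_colourable (m n : nat) (g : R -> 'M[C]_(m, n)) (e : R) :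
  almost_periodic_R g -> 0 < e ->
  finitely_colourable (fun s s' => forall t, vnorm (g (t + s) - g (t + s')) <= e).
Proof.
move=> apg e0; have e40 : 0 < e / 4 by rewrite divr_gt0.
have [d d0 gd] := almost_periodic_unif_continuous apg e40.
have [l l0 gl] := apg.2 _ e40.
pose N := (Num.truncn (l / d)).+1.
apply: (@colourable_cover _ 'I_N (fun s k => forall t,
  vnorm (g (t + s) - g (t + k%:R * d)) <= e / 2)) => [s|s s' k gs gs' t]; last first.
  have := gs t; have := gs' t; rewrite vnormB => h1 h2.
  by have := vnorm_split (g (t + k%:R * d)) (g (t + s)) (g (t + s')); lra.
have [tau gtau /andP[h1 h2]] := gl (s - l).
have r0 : 0 <= (s - tau) / d by rewrite divr_ge0; lra.
have kN : (Num.truncn ((s - tau) / d) < N)%N.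
  by rewrite ltnS le_truncn // ler_pM2r ?invr_gt0 //; lra.
exists (Ordinal kN) => t /=.
have /andP[k1 k2] := truncn_itv r0.
rewrite ler_pdivlMr // in k1; rewrite ltr_pdivrMr // -natr1 mulrDl mul1r in k2.
have h3 := gtau (t + (s - tau)); rewrite (_ : t + (s - tau) + tau = t + s) in h3; last lra.
have h4 : vnorm (g (t + (s - tau)) - g (t + (Num.truncn ((s - tau) / d))%:R * d)) <= e / 4.
  apply: gd; rewrite ler_norml; lra.
have := vnorm_split (g (t + (s - tau))) (g (t + s))
   (g (t + (Num.truncn ((s - tau) / d))%:R * d)); lra.
Qed.

End FiniteColouring.

(** * The nodes *)

Section Nodes.
Variables (R : realType) (tt : int -> R).
Local Notation C := (R[i]).

Definition node_almost_periods (e : R) : set int :=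
  [set T : int | forall (k : nat) (n : int),
    `|(tt (T + n + k%:Z) - tt (T + n)) - (tt (n + k%:Z) - tt n)| <= e].

Hypothesis tt_incr : forall n : int, tt n < tt (n + 1).
Hypothesis tt_ubd : forall M : R, exists n : int, M < tt n.
Hypothesis tt_lbd : forall M : R, exists n : int, tt n < M.
Hypothesis tt_ap : forall e : R, 0 < e -> reldense_Z R (node_almost_periods e).

Lemma node_le (m n : int) : m <= n -> tt m <= tt n.
Proof.
move=> mn; have [k ->] : exists k : nat, n = m + k%:Z by exists `|n - m|%N; lia.
elim: k => [|k IH]; first by rewrite addr0.
by apply: le_trans IH _; rewrite (_ : m + k.+1%:Z = m + k%:Z + 1) ?ltW //; lia.
Qed.

Lemma node_lt_inv (m n : int) : tt m < tt n -> m < n.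
Proof. by move=> mn; rewrite ltNge; apply/negP => /node_le; rewrite leNgt mn. Qed.

Lemma node_locate (s : R) : exists n : int, tt n <= s < tt (n + 1).
Proof.
have [a ta] := tt_lbd s; have [b tb] := tt_ubd s.
have ab : a < b by apply: node_lt_inv; exact: lt_trans tb.
have ex : exists k : nat, s < tt (a + k%:Z).
  by exists `|b - a|%N; rewrite (_ : a + _ = b) //; lia.
case: (ex_minnP ex) => -[|k] sk kmin.
  by rewrite addr0 in sk; have := lt_trans sk ta; rewrite ltxx.
exists (a + k%:Z); rewrite (_ : a + k%:Z + 1 = a + k.+1%:Z) ?sk ?andbT; last lia.
by rewrite leNgt; apply/negP => /kmin; rewrite ltnn.
Qed.

(** Nothing bounds the individual gaps from below. But among any [N] consecutive integers some [T]
    repeats the gap [tt 1 - tt 0 = 2 * g] up to an error [g], so a block of [N + 1] consecutive gaps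
    has length at least [g]. *)
Lemma node_spread : exists (L : nat) (g : R), 0 < g /\
  forall n, tt n + g <= tt (n + L%:Z).
Proof.
pose g := (tt 1 - tt 0) / 2.
have g0 : 0 < g by rewrite divr_gt0 // subr_gt0; have := tt_incr 0; rewrite add0r.
have [N EN] := reldense_cover (tt_ap g0).
exists N.+1, g; split=> // n; have [r /(_ 1%N 0)] := EN (n + N%:Z).
rewrite !addr0 add0r; set T := n + N%:Z - r%:Z; rewrite ler_norml => /andP[h _].
have rN := ltn_ord r.
have h1 : tt n <= tt T by apply: node_le; rewrite /T; lia.
have h2 : tt (T + 1%:Z) <= tt (n + N.+1%:Z) by apply: node_le; rewrite /T; lia.
by rewrite /g in h *; lra.
Qed.

Lemma node_gap_bounded : exists2 W : R, 0 < W & forall n, tt (n + 1) - tt n <= W.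
Proof.
have [N EN] := reldense_cover (tt_ap ltr01).
have w0 n : 0 <= tt (n + 1) - tt n by rewrite subr_ge0 ltW.
exists (1 + \sum_(r < N) (tt (r%:Z + 1) - tt r%:Z)) => [|n].
  by rewrite ltr_pwDl // sumr_ge0.
have [r /(_ 1%N r%:Z)] := EN n; rewrite subrK ler_norml => /andP[_ h].
by rewrite (bigD1 r) //=; have := @sumr_ge0 _ 'I_N (index_enum _) (fun i => i != r)
  (fun r => tt (r%:Z + 1) - tt r%:Z) (fun i _ => w0 i); lra.
Qed.

(** Uniformity in the number [k] of gaps means that the displacement of the nodes under [T] is
    nearly constant, so a single real translation can serve all of them. *)
Lemma node_almost_periodsP (e : R) (T : int) : node_almost_periods e T ->
  forall a n, `|tt (n + T) - tt n - (tt (a + T) - tt a)| <= e.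
Proof.
move=> ET a n; wlog an : a n / a <= n => [H|].
  have [/H //|/ltW/H] := lerP a n.
  by rewrite distrC.
have [k ->] : exists k : nat, n = a + k%:Z by exists `|n - a|%N; lia.
have := ET k a; rewrite (addrC T) (addrAC a T); congr (`|_| <= _); lra.
Qed.

Lemma node_colourable (e : R) : 0 < e ->
  finitely_colourable (fun a b : int => node_almost_periods e (b - a)).
Proof.
move=> e0; have e20 : 0 < e / 2 by rewrite divr_gt0.
have [N EN] := reldense_cover (tt_ap e20).
apply: (@colourable_cover _ 'I_N (fun a r => node_almost_periods (e / 2) (a - r%:Z))).
  exact: EN.
move=> a b r Ea Eb k n.
(* From the base index [n - a + r], the almost periods [a - r] and [b - r] lead to [n] and to
   [b - a + n]. *)
have := Ea k (n - a + r%:Z); have := Eb k (n - a + r%:Z).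
rewrite (_ : b - r%:Z + (n - a + r%:Z) = b - a + n); last lia.
rewrite (_ : a - r%:Z + (n - a + r%:Z) = n); last lia.
by rewrite !ler_norml => /andP[h1 h2] /andP[h3 h4]; apply/andP; split; lra.
Qed.

(** * From the conditions on the intervals between nodes to Bohr almost periodicity *)

Section PiecewiseUniform.
Variables (m n : nat) (f : R -> 'M[C]_(m, n)).
Hypothesis f_piecewise : forall e : R, 0 < e -> exists2 d : R, 0 < d &
  forall (n : int) (t' tau' : R), `|tau'| <= d ->
    tt n <= t' <= tt (n + 1) -> tt n <= t' + tau' <= tt (n + 1) ->
    vnorm (f (t' + tau') - f t') <= e.

(* The intervals [t_n, t_(n+1)] overlap at the nodes, so the estimate chains
   across the at most L nodes met on a short interval. *)
Lemma piecewise_unif_continuous : mx_unif_continuous f.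
Proof.
move=> e e0; have [L [g [g0 Lg]]] := node_spread.
have e'0 : 0 < e / L.+1%:R by rewrite divr_gt0.
have [d d0 fd] := f_piecewise e'0.
set e' := e / L.+1%:R in e'0 fd.
have chain (j : nat) : forall k s t, tt k <= s <= tt (k + 1) -> s <= t ->
    t <= s + d -> t <= tt (k + j.+1%:Z) -> vnorm (f t - f s) <= j.+1%:R * e'.
  elim: j => [|j IH] k s t /andP[ks sk] st tsd tk.
    rewrite mul1r -{1}(subrKC s t); apply: (fd k).
    - by rewrite ger0_norm; lra.
    - by rewrite ks.
    - by rewrite subrKC tk andbT; lra.
  have [tk1|k1t] := lerP t (tt (k + 1)).
    apply: (@le_trans _ _ e'); last by rewrite ler_peMl ?ler1n // ltW.
    rewrite -{1}(subrKC s t); apply: (fd k).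
    - by rewrite ger0_norm; lra.
    - by rewrite ks.
    - by rewrite subrKC tk1 andbT; lra.
  have h1 : vnorm (f t - f (tt (k + 1))) <= j.+1%:R * e'.
    apply: (IH (k + 1)); [by rewrite lexx ltW|exact: ltW|by lra|].
    by rewrite -addrA.
  have h2 : vnorm (f (tt (k + 1)) - f s) <= e'.
    rewrite -{1}(subrKC s (tt (k + 1))); apply: (fd k).
    - by rewrite ger0_norm; lra.
    - by rewrite ks.
    - by rewrite subrKC lexx andbT ltW.
  rewrite -natr1 mulrDl mul1r.
  by have := vnorm_split (f (tt (k + 1))) (f t) (f s); lra.
(* As [s < tt (k + 1)], moving by at most [g / 2] stays below [tt (k + 1 + L)]. The chain thus has
   at most [L + 1] links, each costing [e / (L + 1)]. *)
exists (Num.min d (g / 2)); first by rewrite lt_min d0 divr_gt0.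
move=> s t; wlog st : s t / s <= t => [H|].
  case/orP: (le_total s t) => [|]; first exact: H.
  by rewrite distrC vnormB; exact: H.
rewrite le_min distrC ger0_norm ?subr_ge0 // => /andP[h1 h2].
have [k /andP[ks sk]] := node_locate s.
rewrite vnormB; apply: le_trans (chain L k s t _ st _ _) _.
- by rewrite ks ltW.
- by lra.
- by have := Lg (k + 1); rewrite -addrA; lra.
- by rewrite /e' mulrC divfK.
Qed.

Hypothesis f_ap : forall e : R, 0 < e -> reldense_R [set tau : R | forall t : R,
  (forall n : int, ~ (tt n - e < t < tt n + e)) -> vnorm (f (t + tau) - f t) <= e].

(* Among the L + 1 points t + 2 j e, one avoids all the e-neighbourhoods of the
   nodes; uniform continuity then extends the almost period to all t. *)
Lemma piecewise_almost_periodic : almost_periodic_R f.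
Proof.
split; first exact/mx_unif_continuousW/piecewise_unif_continuous.
move=> e e0; have [L [g [g0 Lg]]] := node_spread.
have e30 : 0 < e / 3 by rewrite divr_gt0.
have [d d0 fd] := piecewise_unif_continuous e30.
(* The trial points span [2 * L * e1], and nodes close to them span less than [2 * (L + 1) * e1].
   The factor [D] keeps the first below [d] and the second below [g]. *)
pose D : R := 4 * L.+1%:R; have D0 : 0 < D by rewrite mulr_gt0.
pose e1 := Num.min (e / 3) (Num.min (g / D) (d / D)).
have e10 : 0 < e1 by rewrite !lt_min e30 !divr_gt0.
have e1e : e1 <= e / 3 by rewrite ge_min lexx.
have e1g : e1 * D <= g by rewrite -ler_pdivlMr // !ge_min lexx orbT.
have e1d : e1 * D <= d by rewrite -ler_pdivlMr // !ge_min lexx !orbT.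
have [l l0 fl] := f_ap e10; exists l => // x.
have [tau ftau xtau] := fl x; exists tau => // t.
have [j jL good] : exists2 j : nat, (j <= L)%N &
    forall n, ~ (tt n - e1 < t + (2 * e1) * j%:R < tt n + e1).
  apply: contrapT => bad.
  have /choice[k kP] : forall j : nat, exists k : int, (j <= L)%N ->
      tt k - e1 < t + (2 * e1) * j%:R < tt k + e1.
    move=> j; have [jL|] := leqP j L; last by exists 0.
    by apply: contrapT => nk; apply: bad; exists j => // p hp; apply: nk; exists p.
  (* The open [e1]-neighbourhoods of points spaced by [2 * e1] are disjoint, so the nodes that spoil
     successive trial points have strictly increasing indices. The last then lies at least [L]
     indices beyond the first, hence at distance at least [g]. *)
  have kj j : (j <= L)%N -> k 0%N + j%:Z <= k j.
    elim: j => [|j IH] jL; first by rewrite addr0.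
    have /andP[h1 h2] := kP _ jL; have /andP[h3 h4] := kP _ (ltnW jL).
    have : k j < k j.+1.
      by apply: node_lt_inv; move: h1 h2; rewrite -natr1; lra.
    by move: (k j) (k j.+1) (k 0%N) (IH (ltnW jL)); clear; lia.
  have h := node_le (kj L (leqnn L)); have h' := Lg (k 0%N).
  have /andP[h1 h2] := kP _ (leq0n L); have /andP[h3 h4] := kP _ (leqnn L).
  by move: e1g; rewrite /D -natr1 => e1g; lra.
have jL' : (j%:R : R) <= L%:R by rewrite ler_nat.
set s := t + (2 * e1) * j%:R in good.
have h0 : 0 <= (2 * e1) * j%:R by rewrite mulr_ge0 // mulr_ge0 // ltW.
have h1 : (2 * e1) * j%:R <= d.
  by apply: le_trans e1d; rewrite /D -natr1; nra.
have h2 := ftau s good.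
have h3 : vnorm (f (t + tau) - f (s + tau)) <= e / 3.
  by apply: fd; rewrite /s ler_norml; lra.
have h4 : vnorm (f s - f t) <= e / 3.
  by apply: fd; rewrite /s ler_norml; lra.
have h5 := vnorm_split (f (s + tau)) (f (t + tau)) (f t).
have h6 := vnorm_split (f s) (f (s + tau)) (f t).
lra.
Qed.

End PiecewiseUniform.
End Nodes.

(** * The propagator *)

Section Propagator.
Variable R : realType.
Local Notation C := (R[i]).

Lemma subr_shuffle (V : zmodType) (a b c d : V) : a + c - (b + d) - (a - b) = c - d.
Proof. by rewrite [- (b + d)]opprD addrACA [LHS]addrAC subrr add0r. Qed.

(** On a step of length [d = 1 / (2 * k)] the growth is at most half of the maximum plus [y], and
    absorbing it shows that [vnorm (D t) + y] at most doubles. The number of steps in a window of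
    length [L] fixes [c], which depends on [k] and [L] only. *)
Lemma mx_Gronwall (k L : R) : 0 < k -> exists2 c : R, 0 < c &
  forall (m n : nat) (D : R -> 'M[C]_(m, n)) (a y : R), mx_continuous D -> 0 <= y ->
  (forall s t S, a <= s -> s <= t -> t <= a + L ->
     (forall v, s <= v <= t -> vnorm (D v) <= S) ->
     vnorm (D t - D s) <= k * (t - s) * (S + y)) ->
  forall t, a <= t <= a + L -> vnorm (D t) <= c * (vnorm (D a) + y).
Proof.
move=> k0; pose d := (2 * k)^-1; have d0 : 0 < d by rewrite invr_gt0 mulr_gt0.
have kd : k * d = 1 / 2 by rewrite /d; field; rewrite gt_eqF.
exists (2 ^+ (Num.truncn (L / d)).+1); first exact: exprn_gt0.
move=> m n D a y cD y0 Dk.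
have step s t : a <= s -> s <= t -> t <= a + L -> t <= s + d ->
    vnorm (D t) + y <= 2 * (vnorm (D s) + y).
  move=> as_ st tL td.
  (* The hypothesis is applied up to the point where the norm is maximal, so that the same maximum
     stands on both sides. *)
  have [c cst Dc] := EVT_max st (continuous_subspaceT (mx_continuous_vnorm cD)).
  have := cst; rewrite in_itv /= => /andP[sc ct].
  have := Dk s c (vnorm (D c)) as_ sc (le_trans ct tL).
  have Dt : vnorm (D t) <= vnorm (D c) by apply: Dc; rewrite in_itv /= st lexx.
  have hv v : s <= v <= c -> vnorm (D v) <= vnorm (D c).
    by move=> /andP[sv vc]; apply: Dc; rewrite in_itv /= sv (le_trans vc).
  move=> /(_ hv) h.
  have h2 := ler_vnormD (D c - D s) (D s); rewrite subrK in h2.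
  have h3 : k * (c - s) * (vnorm (D c) + y) <= 1 / 2 * (vnorm (D c) + y).
    by rewrite ler_wpM2r ?addr_ge0 ?vnorm_ge0 // -kd (ler_wpM2l (ltW k0)) //; lra.
  by lra.
have steps (j : nat) : forall t, a <= t -> t <= a + L -> t <= a + j%:R * d ->
    vnorm (D t) + y <= 2 ^+ j * (vnorm (D a) + y).
  elim: j => [|j IH] t at_ tL tj.
    rewrite mul0r addr0 in tj; have -> : t = a by apply/eqP; rewrite eq_le tj.
    by rewrite mul1r.
  have Da0 : 0 <= vnorm (D a) + y by rewrite addr_ge0 ?vnorm_ge0.
  have [/(IH _ at_ tL) h|jt] := lerP t (a + j%:R * d).
    apply: le_trans h _; rewrite ler_wpM2r // exprS ler_peMl ?exprn_ge0 //; lra.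
  have jd : 0 <= j%:R * d by rewrite mulr_ge0 // ltW.
  rewrite -natr1 mulrDl mul1r in tj.
  have h1 := IH (a + j%:R * d) ltac:(lra) ltac:(lra) ltac:(lra).
  have h2 := step (a + j%:R * d) t ltac:(lra) ltac:(lra) ltac:(lra) ltac:(lra).
  by rewrite exprS -mulrA; apply: le_trans h2 _; rewrite ler_wpM2l.
move=> t /andP[at_ tL]; have L0 : 0 <= L by lra.
apply: (@le_trans _ _ (vnorm (D t) + y)); first by rewrite lerDl.
apply: steps => //; apply: le_trans tL _; rewrite lerD2l -ler_pdivrMr // ltW //.
by have /andP[] := truncn_itv (divr_ge0 L0 (ltW d0)).
Qed.

Variables (q : nat) (A X : R -> 'M[C]_q).
Hypotheses (apA : almost_periodic_R A) (fX : fundamental_matrix A X).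
Local Notation U := (Xts X).

Let cX : mx_continuous X := fX.1.
Let uX : forall t, X t \in unitmx := fX.2.2.

Lemma propagator_cat (t s r : R) : U t r = U t s *m U s r.
Proof. by rewrite /Xts mulmxA -(mulmxA (X t)) mulVmx // mulmx1. Qed.

Lemma propagator_id (t : R) : U t t = 1%:M.
Proof. by rewrite /Xts mulmxV. Qed.

Lemma propagator_continuous_l (s : R) : mx_continuous (fun t => U t s).
Proof. exact/mx_continuousM/mx_continuous_cst. Qed.

Lemma propagator_continuous_r (t : R) : mx_continuous (fun s => U t s).
Proof. by apply: mx_continuousM; [exact: mx_continuous_cst|exact: mx_continuousV]. Qed.

Lemma propagator_integrand_continuous (s : R) : mx_continuous (fun v => A v *m U v s).
Proof. exact: mx_continuousM apA.1 (propagator_continuous_l s). Qed.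

Lemma propagator_eq (a s t : R) : s <= t ->
  U t a = U s a + cint s t (fun v => A v *m U v a).
Proof.
move=> st; rewrite {1}/Xts (fX.2.1 _ _ st) mulmxDl; congr (_ + _).
rewrite -cint_mulmxr; last exact: mx_continuousM apA.1 cX.
by apply: eq_cint => v _; rewrite /Xts mulmxA.
Qed.

Local Notation kappa := (cint_cst R q q).

Lemma propagator_bounded (L : R) : exists2 c : R, 0 < c &
  forall s t, s <= t <= s + L -> vnorm (U t s) <= c.
Proof.
have [M M0 AM] := almost_periodic_R_bounded apA.
have k0 : 0 < kappa * M + 1 by rewrite ltr_wpDl // mulr_ge0 ?cint_cst_ge0 // ltW.
have [c c0 cG] := mx_Gronwall L k0.
(* The added 1 keeps the constant positive when [q = 0]. *)
exists (c * (vnorm (1%:M : 'M[C]_q) + 1)).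
  by rewrite mulr_gt0 // ltr_wpDl // vnorm_ge0.
move=> s t st; have := cG _ _ (fun t => U t s) s 0 (propagator_continuous_l s) (lexx _).
move=> /(_ _ t st)H; apply: le_trans (H _) _.
  move=> r v S sr rv vL US; rewrite (propagator_eq s rv) addrC addKr addr0.
  have S0 : 0 <= S by apply: le_trans (US v _); rewrite ?vnorm_ge0 ?rv ?lexx.
  apply: le_trans (vnorm_cint (x := M * S) (propagator_integrand_continuous s) rv _) _.
    move=> w /US h; apply: le_trans (ler_vnormM _ _) _.
    by rewrite ler_pM ?vnorm_ge0.
  rewrite (_ : kappa * _ = kappa * M * ((v - r) * S)); last by ring.
  rewrite -[X in _ <= X]mulrA ler_wpM2r ?lerDl //.
  by rewrite mulr_ge0 // subr_ge0.
by rewrite propagator_id ler_pM2l // lerD2l.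
Qed.

(** The difference [D] of the two propagators vanishes at [t = s] and solves D' = A(t + tau) D +
    (A(t + tau) - A(t)) U, whose forcing term is at most [c1 * e]; Gronwall's inequality applies
    with [y = c1 * e]. *)
Lemma propagator_shift (L : R) : exists2 c : R, 0 < c & forall e tau, 0 <= e ->
  (forall t, vnorm (A (t + tau) - A t) <= e) ->
  forall s t, s <= t <= s + L -> vnorm (U (t + tau) (s + tau) - U t s) <= c * e.
Proof.
have [M M0 AM] := almost_periodic_R_bounded apA.
have [c1 c10 Uc1] := propagator_bounded L.
(* The integrand below is at most [M * S + c1 * e], hence at most [(M + 1) * (S + c1 * e)], the form
   that [mx_Gronwall] expects. *)
have k0 : 0 < kappa * (M + 1) + 1 by rewrite ltr_wpDl // mulr_ge0 ?cint_cst_ge0 // addr_ge0 // ltW.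
have [c c0 cG] := mx_Gronwall L k0.
exists (c * c1); first by rewrite mulr_gt0.
move=> e tau e0 Ae s t st.
pose D t := U (t + tau) (s + tau) - U t s.
have cUs : mx_continuous (fun t => U (t + tau) (s + tau)).
  exact: (mx_continuous_shift tau (propagator_continuous_l (s + tau))).
have cD : mx_continuous D.
  by apply: mx_continuousD => //; apply: mx_continuousN; exact: propagator_continuous_l.
have y0 : 0 <= c1 * e by rewrite mulr_ge0 // ltW.
have := cG _ _ D s (c1 * e) cD y0.
move=> /(_ _ t st)H; apply: le_trans (H _) _; last first.
  by rewrite {1}/D !propagator_id subrr vnorm0 add0r mulrA.
move=> r v S sr rv vL US.
have S0 : 0 <= S by apply: le_trans (US v _); rewrite ?vnorm_ge0 ?rv ?lexx.
have cA : mx_continuous A := apA.1.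
have cAs : mx_continuous (fun t => A (t + tau)) := mx_continuous_shift tau cA.
have -> : D v - D r = cint r v (fun w => A (w + tau) *m D w + (A (w + tau) - A w) *m U w s).
  have rv' : r + tau <= v + tau by rewrite lerD2r.
  rewrite /D (propagator_eq (s + tau) rv') (propagator_eq s rv).
  rewrite cint_shift //; last exact: propagator_integrand_continuous.
  rewrite subr_shuffle -cintB.
  - by apply: eq_cint => w _; rewrite mulmxBr mulmxBl addrA subrK.
  - exact: mx_continuousM cAs cUs.
  - exact: propagator_integrand_continuous.
have cI : mx_continuous (fun w => A (w + tau) *m D w + (A (w + tau) - A w) *m U w s).
  have cAd := mx_continuousD cAs (mx_continuousN cA).
  exact (mx_continuousD (mx_continuousM cAs cD) (mx_continuousM cAd (propagator_continuous_l s))).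
apply: le_trans (vnorm_cint (x := M * S + c1 * e) cI rv _) _.
  move=> w /[dup] /US h /andP[rw wv].
  apply: le_trans (ler_vnormD _ _) _; apply: lerD.
    by apply: le_trans (ler_vnormM _ _) _; rewrite ler_pM ?vnorm_ge0.
  apply: le_trans (ler_vnormM _ _) _; rewrite mulrC ler_pM ?vnorm_ge0 //.
  by apply: Uc1; rewrite (le_trans sr rw) (le_trans wv vL).
rewrite [X in X <= _]mulrA; apply: (@le_trans _ _ (kappa * (v - r) * ((M + 1) * (S + c1 * e)))).
  rewrite ler_wpM2l ?mulr_ge0 ?subr_ge0 ?cint_cst_ge0 //.
  by have := mulr_ge0 (ltW M0) y0; clear - apA cX uX S0; lra.
rewrite mulrA ler_wpM2r ?addr_ge0 // mulrAC ler_wpM2r ?subr_ge0 //.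
by rewrite lerDl.
Qed.

Lemma propagator_lipschitz (L : R) : exists2 c : R, 0 < c &
  forall s t, s <= t <= s + L -> vnorm (U t s - 1%:M) <= c * (t - s).
Proof.
have [M M0 AM] := almost_periodic_R_bounded apA.
have [c1 c10 Uc1] := propagator_bounded L.
exists (kappa * (M * c1) + 1); first by rewrite ltr_wpDl // !mulr_ge0 ?cint_cst_ge0 // ltW.
move=> s t /andP[st tL]; rewrite (propagator_eq s st) propagator_id addrC addKr.
apply: le_trans (vnorm_cint (x := M * c1) (propagator_integrand_continuous s) st _) _.
  move=> v /andP[sv vt]; apply: le_trans (ler_vnormM _ _) _.
  rewrite ler_pM ?vnorm_ge0 //; apply: Uc1; rewrite sv (le_trans vt) //.
rewrite (_ : kappa * _ = kappa * (M * c1) * (t - s)); last by ring.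
by rewrite mulrDl mul1r lerDl subr_ge0.
Qed.

(** The cocycle rule writes [U b1 a0] as [U b a] between two factors over the short end intervals,
    and these are near the identity. *)
Lemma propagator_nested (L : R) : exists2 c : R, 0 < c &
  forall a0 a b b1, a0 <= a -> a <= b -> b <= b1 -> b1 <= a0 + L ->
  vnorm (U b1 a0 - U b a) <= c * ((a - a0) + (b1 - b)).
Proof.
have [c1 c10 Uc1] := propagator_bounded L.
have [c2 c20 Uc2] := propagator_lipschitz L.
exists (c2 * (c1 * c1) + c1 * c2); first by rewrite addr_gt0 // !mulr_gt0.
move=> a0 a b b1 h1 h2 h3 h4.
rewrite (propagator_cat b1 b a0) (propagator_cat b a a0).
rewrite (_ : _ - _ = (U b1 b - 1%:M) *m (U b a *m U a a0) + U b a *m (U a a0 - 1%:M));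
  last by rewrite mulmxBl mul1mx mulmxBr mulmx1 addrA subrK.
have k1 : vnorm ((U b1 b - 1%:M) *m (U b a *m U a a0)) <= c2 * (b1 - b) * (c1 * c1).
  apply: le_trans (ler_vnormM _ _) _; rewrite ler_pM ?vnorm_ge0 //.
    by apply: Uc2; apply/andP; clear - apA cX uX h1 h2 h3 h4; split; lra.
  apply: le_trans (ler_vnormM _ _) _.
  by rewrite ler_pM ?vnorm_ge0 // Uc1 //; apply/andP; clear - apA cX uX h1 h2 h3 h4; split; lra.
have k2 : vnorm (U b a *m (U a a0 - 1%:M)) <= c1 * (c2 * (a - a0)).
  apply: le_trans (ler_vnormM _ _) _; rewrite ler_pM ?vnorm_ge0 //.
    by apply: Uc1; apply/andP; clear - apA cX uX h1 h2 h3 h4; split; lra.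
  by apply: Uc2; apply/andP; clear - apA cX uX h1 h2 h3 h4; split; lra.
apply: le_trans (ler_vnormD _ _) _.
have p1 : 0 <= c2 * (c1 * c1) * (a - a0) by rewrite !mulr_ge0 ?subr_ge0 // ltW.
have p2 : 0 <= c1 * c2 * (b1 - b) by rewrite !mulr_ge0 ?subr_ge0 // ltW.
apply: le_trans (lerD k1 k2) _; clear - apA cX uX p1 p2; lra.
Qed.

(** * Duhamel integrals *)

Variables (p : nat) (g : R -> 'M[C]_(q, p)).
Hypothesis apg : almost_periodic_R g.

(** Variation of constants: the value at [b] of the solution of x' = A x + g that vanishes at [a].
    The free width [p] covers both [g = f], which gives [hvec], and [g = B], which gives the
    integral part of [Hmat]. *)
Definition duhamel (b a : R) : 'M[C]_(q, p) := cint a b (fun u => U b u *m g u).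

Lemma duhamel_integrand_continuous (b : R) : mx_continuous (fun u => U b u *m g u).
Proof. exact: mx_continuousM (propagator_continuous_r b) apg.1. Qed.

Lemma duhamel_part_bounded (L : R) : exists2 c : R, 0 < c & forall a a' b, a <= a' ->
  a' <= b -> b <= a + L -> vnorm (cint a a' (fun u => U b u *m g u)) <= c * (a' - a).
Proof.
have [M M0 gM] := almost_periodic_R_bounded apg.
have [c1 c10 Uc1] := propagator_bounded L.
exists (cint_cst R q p * (c1 * M) + 1); first by rewrite ltr_wpDl // !mulr_ge0 ?cint_cst_ge0 // ltW.
move=> a a' b h1 h2 h3.
apply: le_trans (vnorm_cint (x := c1 * M) (duhamel_integrand_continuous b) h1 _) _.
  move=> v /andP[sv vt]; apply: le_trans (ler_vnormM _ _) _.
  rewrite ler_pM ?vnorm_ge0 //; apply: Uc1; apply/andP; clear - apA cX uX apg h1 h2 h3 sv vt; split; lra.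
rewrite (_ : cint_cst R q p * _ = cint_cst R q p * (c1 * M) * (a' - a)); last by ring.
by rewrite mulrDl mul1r lerDl subr_ge0.
Qed.

Lemma duhamel_shift (L : R) : exists2 c : R, 0 < c & forall e tau, 0 <= e ->
  (forall t, vnorm (A (t + tau) - A t) <= e) ->
  (forall t, vnorm (g (t + tau) - g t) <= e) ->
  forall s t, s <= t <= s + L -> vnorm (duhamel (t + tau) (s + tau) - duhamel t s) <= c * e.
Proof.
have [M M0 gM] := almost_periodic_R_bounded apg.
have [c1 c10 Uc1] := propagator_bounded L.
have [c2 c20 Uc2] := propagator_shift L.
(* The sign of [L] is arbitrary; the absolute value keeps the constant positive. *)
exists (cint_cst R q p * (`|L| * (c2 * M + c1)) + 1).
  by rewrite ltr_wpDl // !mulr_ge0 ?cint_cst_ge0 // addr_ge0 ?mulr_ge0 // ltW.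
move=> e tau e0 Ae ge s t /andP[st tL].
rewrite /duhamel cint_shift //; last exact: duhamel_integrand_continuous.
have cs : mx_continuous (fun u => U (t + tau) (u + tau) *m g (u + tau)).
  exact: (mx_continuous_shift tau (duhamel_integrand_continuous (t + tau))).
have cI := duhamel_integrand_continuous t.
rewrite -cintB //.
have cB : mx_continuous (fun u => U (t + tau) (u + tau) *m g (u + tau) - U t u *m g u).
  by apply: mx_continuousD => //; exact: mx_continuousN.
apply: le_trans (vnorm_cint (x := (c2 * M + c1) * e) cB st _) _.
  move=> u /andP[su ut].
  rewrite (_ : _ - _ = (U (t + tau) (u + tau) - U t u) *m g (u + tau)
     + U t u *m (g (u + tau) - g u)); last by rewrite mulmxBl mulmxBr addrA subrK.
  apply: le_trans (ler_vnormD _ _) _; rewrite mulrDl; apply: lerD.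
    apply: le_trans (ler_vnormM _ _) _; rewrite mulrAC ler_pM ?vnorm_ge0 //.
    by apply: Uc2 => //; apply/andP; clear - apA cX uX apg st tL su ut; split; lra.
  apply: le_trans (ler_vnormM _ _) _; rewrite ler_pM ?vnorm_ge0 //.
  by apply: Uc1 => //; apply/andP; clear - apA cX uX apg st tL su ut; split; lra.
rewrite [X in _ <= X]mulrDl mul1r -[X in _ <= X + _]mulrA.
apply: (@le_trans _ _ (cint_cst R q p * (`|L| * (c2 * M + c1) * e))); last by rewrite lerDl.
rewrite ler_wpM2l ?cint_cst_ge0 // -mulrA ler_wpM2r //.
  by rewrite mulr_ge0 // addr_ge0 ?mulr_ge0 // ltW.
by rewrite ger0_norm; clear - apA cX uX apg st tL; lra.
Qed.

(** The integrals over the two end pieces are short. On the middle piece the cocycle rule factors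
    out [U b1 b], which is near the identity. *)
Lemma duhamel_nested (L : R) : exists2 c : R, 0 < c &
  forall a0 a b b1, a0 <= a -> a <= b -> b <= b1 -> b1 <= a0 + L ->
  vnorm (duhamel b1 a0 - duhamel b a) <= c * ((a - a0) + (b1 - b)).
Proof.
have [c1 c10 Uc1] := duhamel_part_bounded L.
have [c2 c20 Uc2] := propagator_lipschitz L.
exists (c1 + c2 * (c1 * `|L|)); first by rewrite ltr_pwDl // !mulr_ge0 // ltW.
move=> a0 a b b1 h1 h2 h3 h4; have cI := duhamel_integrand_continuous b1.
rewrite /duhamel (cint_cat cI h1 (le_trans h2 h3)) (cint_cat cI h2 h3).
have -> : cint a b (fun u => U b1 u *m g u) = U b1 b *m duhamel b a.
  rewrite -cint_mulmxl; last exact: duhamel_integrand_continuous.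
  by apply: eq_cint => u _; rewrite (propagator_cat b1 b u) mulmxA.
rewrite -/(duhamel b a) (_ : _ - _ = cint a0 a (fun u => U b1 u *m g u) +
  cint b b1 (fun u => U b1 u *m g u) + (U b1 b - 1%:M) *m duhamel b a); last first.
  by rewrite mulmxBl mul1mx -!addrA; congr (_ + _); rewrite addrCA.
have k1 := Uc1 a0 a b1 h1 (le_trans h2 h3) h4.
have k2 := Uc1 b b1 b1 h3 (lexx _) ltac:(clear - apA cX uX apg h1 h2 h3 h4; lra).
have k3 : vnorm ((U b1 b - 1%:M) *m duhamel b a) <= c2 * (b1 - b) * (c1 * `|L|).
  apply: le_trans (ler_vnormM _ _) _; rewrite ler_pM ?vnorm_ge0 //.
    by apply: Uc2; apply/andP; clear - apA cX uX apg h1 h2 h3 h4; split; lra.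
  apply: le_trans (Uc1 a b b h2 (lexx _) ltac:(clear - apA cX uX apg h1 h2 h3 h4; lra)) _.
  by rewrite (ler_wpM2l (ltW c10)) // ger0_norm; clear - apA cX uX apg h1 h2 h3 h4; lra.
apply: le_trans (ler_vnormD _ _) _.
have p1 : 0 <= c2 * (c1 * `|L|) * (a - a0) by rewrite !mulr_ge0 ?subr_ge0 // ltW.
apply: le_trans (lerD (le_trans (ler_vnormD _ _) (lerD k1 k2)) k3) _.
by clear - apA cX uX apg p1; lra.
Qed.

End Propagator.

(** * Almost periodicity of the coefficients *)

Section CommonAlmostPeriods.
Variable R : realType.
Local Notation C := (R[i]).

(** After translation by [-tau], the interval [[a', b']] has its ends within [e] of those of
    [[a, b]], but neither need contain the other. Both are therefore compared with their hull
    [[l, r]], whose length is at most [W + 2] because [e <= 1]. Each comparison costs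
    [c2 * (e + e)], whence [4 * c2]. *)
Lemma shifted_interval_perturbation (m n : nat) (P : R -> R -> 'M[C]_(m, n))
    (Q : R -> R -> Prop) (W : R) :
  (forall L, exists2 c : R, 0 < c & forall e tau, 0 <= e -> Q e tau ->
     forall s t, s <= t <= s + L -> vnorm (P (t + tau) (s + tau) - P t s) <= c * e) ->
  (forall L, exists2 c : R, 0 < c & forall a0 a b b1,
     a0 <= a -> a <= b -> b <= b1 -> b1 <= a0 + L ->
     vnorm (P b1 a0 - P b a) <= c * ((a - a0) + (b1 - b))) ->
  exists2 c : R, 0 < c & forall e tau a b a' b', 0 <= e <= 1 -> Q e tau ->
    a <= b <= a + W -> a' <= b' -> `|a' - a - tau| <= e -> `|b' - b - tau| <= e ->
    vnorm (P b' a' - P b a) <= c * e.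
Proof.
move=> /(_ (W + 2))[c1 c10 P1] /(_ (W + 2))[c2 c20 P2].
exists (c1 + 4 * c2); first by rewrite addr_gt0 // mulr_gt0.
move=> e tau a b a' b' /andP[e0 e1] Qe /andP[ab bW] ab'.
rewrite !ler_norml => /andP[a1 a2] /andP[b1 b2].
have P1' := P1 e tau e0 Qe (a' - tau) (b' - tau); rewrite !subrK in P1'.
set a'' := a' - tau in P1'; set b'' := b' - tau in P1'.
pose l := Num.min a a''; pose r := Num.max b b''.
have la : l <= a by rewrite ge_min lexx.
have la'' : l <= a'' by rewrite ge_min lexx orbT.
have br : b <= r by rewrite le_max lexx.
have br'' : b'' <= r by rewrite le_max lexx orbT.
have ab'' : a'' <= b'' by rewrite lerD2r.
have al : a - e <= l by rewrite le_min; apply/andP; split; rewrite /a''; lra.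
have rb : r <= b + e by rewrite ge_max; apply/andP; split; rewrite /b''; lra.
have al'' : a'' - e <= l by rewrite le_min; apply/andP; split; rewrite /a''; lra.
have rb'' : r <= b'' + e by rewrite ge_max; apply/andP; split; rewrite /b''; lra.
have lr : r <= l + (W + 2) by lra.
have h1 : vnorm (P b' a' - P b'' a'') <= c1 * e.
  by apply: P1'; rewrite ab''; lra.
have h2 : vnorm (P r l - P b a) <= c2 * (e + e).
  apply: le_trans (P2 _ _ _ _ la ab br lr) _; rewrite ler_pM2l //; lra.
have h3 : vnorm (P r l - P b'' a'') <= c2 * (e + e).
  apply: le_trans (P2 _ _ _ _ la'' ab'' br'' lr) _.
  by rewrite ler_pM2l //; lra.
rewrite vnormB in h3.
have h4 := vnorm_split (P b'' a'') (P b' a') (P b a).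
have h5 := vnorm_split (P r l) (P b'' a'') (P b a).
have -> : (c1 + 4 * c2) * e = c1 * e + (c2 * (e + e) + c2 * (e + e)) by ring.
exact: le_trans h4 (lerD h1 (le_trans h5 (lerD h3 h2))).
Qed.

Lemma Hmat_duhamel (q : nat) (A B X : R -> 'M[C]_q) (tt : int -> R) (n : int) :
  almost_periodic_R B -> fundamental_matrix A X ->
  Hmat X B tt n = Xts X (tt (n + 1)) (tt n) + duhamel X B (tt (n + 1)) (tt n).
Proof.
move=> apB fX; rewrite /Hmat /Zn /Jn mulmxDr mulmx1; congr (_ + _).
rewrite -cint_mulmxl; last exact: (duhamel_integrand_continuous fX apB).
by apply: eq_cint => u _; rewrite mulmxA -(propagator_cat fX).
Qed.

Lemma Hmat_hvec_almost_periodic (q : nat) (tt : int -> R) (A B X : R -> 'M[C]_q)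
    (f : R -> 'cV[C]_q) :
  (forall n : int, tt n < tt (n + 1)) ->
  (forall e : R, 0 < e -> reldense_Z R (node_almost_periods tt e)) ->
  fundamental_matrix A X ->
  almost_periodic_R A -> almost_periodic_R B -> almost_periodic_R f ->
  forall e : R, 0 < e -> reldense_Z R [set T : int | forall n : int,
    vnorm (Hmat X B tt (n + T) - Hmat X B tt n) <= e /\
    vnorm (hvec X f tt (n + T) - hvec X f tt n) <= e].
Proof.
move=> tt_incr tt_ap fX apA apB apf e e0.
have [W W0 ttW] := node_gap_bounded tt_incr tt_ap.
have [c1 c10 P1] := shifted_interval_perturbation W
  (propagator_shift apA fX) (propagator_nested apA fX).
pose Q (p : nat) (g : R -> 'M[C]_(q, p)) e tau :=
  (forall t, vnorm (A (t + tau) - A t) <= e) /\ (forall t, vnorm (g (t + tau) - g t) <= e).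
have shiftQ (p : nat) (g : R -> 'M[C]_(q, p)) (apg : almost_periodic_R g) (L : R) :
    exists2 c : R, 0 < c & forall e tau, 0 <= e -> Q p g e tau ->
    forall s t, s <= t <= s + L ->
    vnorm (duhamel X g (t + tau) (s + tau) - duhamel X g t s) <= c * e.
  have [c c0 h] := duhamel_shift apA fX apg L.
  by exists c => // e' tau e'0 [h1 h2]; exact: h.
have [c2 c20 P2] := shifted_interval_perturbation W (shiftQ _ _ apB) (duhamel_nested apA fX apB).
have [c3 c30 P3] := shifted_interval_perturbation W (shiftQ _ _ apf) (duhamel_nested apA fX apf).
pose c := c1 + c2 + c3; have c0 : 0 < c by rewrite !addr_gt0.
pose d := Num.min 1 (e / c); have d0 : 0 < d by rewrite lt_min ltr01 divr_gt0.
have d1 : 0 <= d <= 1 by rewrite (ltW d0) ge_min lexx.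
have cd : c * d <= e by rewrite mulrC -ler_pdivlMr // ge_min lexx orbT.
have cd1 : (c1 + c2) * d <= e.
  by apply: le_trans cd; rewrite ler_pM2r // /c lerDl ltW.
have cd2 : c3 * d <= e.
  by apply: le_trans cd; rewrite ler_pM2r // /c lerDr ltW // addr_gt0.
apply: colourable_reldense.
have col (p : nat) (g : R -> 'M[C]_(q, p)) : almost_periodic_R g ->
    finitely_colourable (fun a b : int => forall t,
      vnorm (g (t + (tt b - tt a)) - g t) <= d).
  move=> apg; have := colourable_comp tt (almost_periodic_R_colourable apg d0).
  apply: colourable_sub => a b h t; rewrite vnormB; have := h (t - tt a).
  by rewrite subrK (_ : t - tt a + tt b = t + (tt b - tt a)) // -addrA (addrC (- tt a)).
have := colourable_and (node_colourable tt_ap d0)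
  (colourable_and (col _ _ apA) (colourable_and (col _ _ apB) (col _ _ apf))).
apply: colourable_sub => a b [/node_almost_periodsP near_tt [Ad [Bd fd]]] n.
(* One translation [tt b - tt a] brings each node within [d] of the node [b - a] places further,
   which is the hypothesis on end points in [P1], [P2] and [P3]. *)
have nd k : `|tt (k + (b - a)) - tt k - (tt b - tt a)| <= d.
  by have := near_tt a k; rewrite [a + (b - a)]addrC subrK.
have itv : tt n <= tt (n + 1) <= tt n + W.
  by rewrite ltW //=; have := ttW n; rewrite lerBlDl addrC.
have itv' : tt (n + (b - a)) <= tt (n + (b - a) + 1) by rewrite ltW.
have nd1 := nd (n + 1); rewrite (addrAC n) in nd1.
split.
  rewrite !(Hmat_duhamel _ _ apB fX) opprD addrACA.
  apply: le_trans (ler_vnormD _ _) _; apply: le_trans cd1; rewrite mulrDl.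
  apply: lerD; first exact: (P1 _ _ _ _ _ _ d1 Ad itv itv' (nd n) nd1).
  exact: (P2 _ _ _ _ _ _ d1 (conj Ad Bd) itv itv' (nd n) nd1).
apply: le_trans cd2.
exact: (P3 _ _ _ _ _ _ d1 (conj Ad fd) itv itv' (nd n) nd1).
Qed.

End CommonAlmostPeriods.

(** * The Green operator *)

Section GreenOperator.
Variable R : realType.
Local Notation C := (R[i]).

Lemma subr_addC_shuffle (V : zmodType) (x y z w : V) :
  z - (x + w) = (y - x) - (y + w - z).
Proof.
by rewrite opprB [RHS]addrCA (opprD y) [y - x + _]addrA [y - x - y]addrAC subrr add0r opprD.
Qed.

Lemma le_geometric_eq0 (x D rho : R) : 0 < rho -> rho < 1 -> 0 <= x ->
  (forall j : nat, x <= D * rho ^+ j) -> x = 0.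
Proof.
move=> r0 r1 x0 xD; apply/eqP; rewrite eq_le x0 andbT.
have cv : D * rho ^+ j @[j --> \oo] --> (0 : R).
  by apply: cvg_geometric; rewrite ger0_norm // ltW.
by rewrite -(cvg_lim _ cv) //; apply: limr_ge; [exact: cvgP cv|exact: nearW].
Qed.

Lemma geometric_increments_cvg (u : nat -> R) (D rho : R) : 0 < rho -> rho < 1 ->
  (forall N, `|u N.+1 - u N| <= D * rho ^+ N) -> cvgn u.
Proof.
move=> r0 r1 uD.
have ct : cvgn (series (telescope u)).
  apply: normed_cvg; apply: (@series_le_cvg _ _ (geometric D rho)) => [n|n|n|].
  - exact: normr_ge0.
  - exact: le_trans (uD n).
  - exact: uD.
  - by apply: is_cvg_geometric_series; rewrite ger0_norm // ltW.
have -> : u = fun n => u 0%N + series (telescope u) n.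
  by apply/funext => n; rewrite telescopeK /= addrC subrK.
by apply: is_cvgD; [exact: is_cvg_cst|].
Qed.

(** The full two-sided series has sum (1 + rho) / (1 - rho). A telescoping majorant avoids splitting
    at [p], which may lie outside the range of summation. *)
Lemma sum_geometric_dist (rho : R) (p : int) (M : nat) : 0 < rho -> rho < 1 ->
  \sum_(0 <= i < M) rho ^+ `|p - i%:Z|%N <= 2 / (1 - rho).
Proof.
move=> r0 r1.
(* [phi] increases from [0] to [2] with increments at least [(1 - rho) rho^|p - i|]. *)
pose phi (i : int) : R := if i <= p then rho ^+ `|p - i|%N.+1 else 2 - rho ^+ `|i - p|%N.-1.
have phi_ge0 i : 0 <= phi i.
  rewrite /phi; case: ifP => _; first by rewrite exprn_ge0 // ltW.
  have : rho ^+ `|i - p|%N.-1 <= 1 by rewrite exprn_ile1 // ltW.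
  by lra.
have phi_le2 i : phi i <= 2.
  rewrite /phi; case: ifP => _; last by rewrite lerBlDr lerDl exprn_ge0 // ltW.
  have : rho ^+ `|p - i|%N.+1 <= 1 by rewrite exprn_ile1 // ltW.
  by lra.
have phi_incr (i : int) : (1 - rho) * rho ^+ `|p - i|%N <= phi (i + 1) - phi i.
  rewrite /phi; case: (ltrgtP i p) => ip.
  - rewrite (_ : i + 1 <= p); last lia.
    rewrite (_ : `|p - i|%N = `|p - (i + 1)%R|%N.+1); last lia.
    by rewrite mulrBl mul1r -exprS.
  - rewrite (_ : (i + 1 <= p) = false); last lia.
    rewrite (_ : `|(i + 1)%R - p|%N.-1 = `|i - p|%N.-1.+1); last lia.
    rewrite (_ : `|p - i|%N = `|i - p|%N.-1.+1); last lia.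
    have x0 : 0 <= rho ^+ `|i - p|%N.-1 by rewrite exprn_ge0 // ltW.
    rewrite exprS; move: (rho ^+ _) x0 => x x0.
    by have := mulr_ge0 x0 (sqr_ge0 (1 - rho)); rewrite expr2; lra.
  - rewrite ip (_ : (p + 1 <= p) = false); last lia.
    rewrite (_ : `|(p + 1)%R - p|%N.-1 = 0%N); last lia.
    by rewrite subrr /= expr0 expr1; lra.
rewrite ler_pdivlMr ?subr_gt0 // mulrC mulr_sumr.
apply: (@le_trans _ _ (\sum_(0 <= i < M) (phi i.+1%:Z - phi i%:Z))).
  by apply: ler_sum => i _; have := phi_incr i%:Z; rewrite -addn1 PoszD.
rewrite (telescope_sumr (fun i => phi i%:Z)) //.
by have := phi_ge0 0%:Z; have := phi_le2 M%:Z; lra.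
Qed.

Lemma vnorm_le_eps (m n : nat) (M : 'M[C]_(m, n)) (x k : R) : 0 <= k ->
  (forall e, 0 < e -> vnorm M <= x + k * e) -> vnorm M <= x.
Proof.
move=> k0 Mx; apply/ler_addgt0Pr => e e0.
apply: le_trans (Mx (e / (k + 1)) _) _; first by rewrite divr_gt0 // ltr_wpDl.
rewrite lerD2l mulrCA -[X in _ <= X]mulr1 ler_pM2l // ler_pdivrMr ?ltr_wpDl //.
by rewrite mul1r lerDl.
Qed.

Variables (q : nat) (H Phi : int -> 'M[C]_q) (Pi : 'M[C]_q) (K rho : R).
Hypothesis PhiH : forall n : int, Phi (n + 1) = H n *m Phi n.
Hypothesis uPhi : forall n : int, Phi n \in unitmx.
Hypotheses (K0 : 0 < K) (rho0 : 0 < rho) (rho1 : rho < 1).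
Hypothesis G_bound : forall n k : int,
  vnorm (Green Phi Pi n k) <= K * rho ^+ `|n - k|%N.
Local Notation G := (Green Phi Pi).

(** Each branch of the Green function solves the homogeneous system in [n]. The branches switch only
    when passing from [n = k] to [n = k + 1], where the parts with [Pi] and [1 - Pi] add up to a
    jump equal to the identity. *)
Lemma Green_step (n k : int) : G (n + 1) k = H n *m G n k + (k == n)%:R%:M.
Proof.
rewrite /Green; have [->|kn] := eqVneq k n.
  rewrite ltxx (_ : n < n + 1) ?ltzD1 ?lexx // mulmxN !mulmxA -PhiH.
  rewrite mulmxBr mulmx1 mulmxBl mulmxV // opprB subrK.
  by [].
rewrite (_ : (k < n + 1) = (k < n)); last by rewrite ltzD1 le_eqVlt (negbTE kn).
by rewrite raddf0 addr0 PhiH; case: ifP => _; rewrite ?mulmxN !mulmxA.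
Qed.

Lemma green_psum_step (h : int -> 'cV[C]_q) (n : int) (N : nat) : (`|n| <= N)%N ->
  green_psum Phi Pi h (n + 1) N = H n *m green_psum Phi Pi h n N + h n.
Proof.
move=> nN; rewrite /green_psum mulmx_sumr.
under eq_bigr => i _ do rewrite Green_step mulmxDl -mulmxA.
rewrite big_split /=; congr (_ + _); rewrite big_mkord.
(* The position [n + N] carries the index [k = n] of the jump; it is inside the window since [N] is
   at least the absolute value of [n]. *)
have i0P : (`|(n + N%:Z)%R| < (N + N).+1)%N by lia.
have i0E : `|(n + N%:Z)%R|%N%:Z - N%:Z = n by lia.
rewrite (bigD1 (Ordinal i0P)) //= i0E eqxx mul1mx big1 ?addr0 // => i.
move=> /eqP ii0; rewrite (_ : (_ == n) = false) ?raddf0 ?mul0mx //.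
apply/negbTE/eqP => E; apply: ii0; apply: val_inj => /=; lia.
Qed.

(** * The Green series of a bounded forcing term *)

Section BoundedForcing.
Variables (h : int -> 'cV[C]_q) (b : R).
Hypothesis hb : forall k, vnorm (h k) <= b.
Local Notation psum := (green_psum Phi Pi h).
Local Notation c := (green_sum Phi Pi h).

Let b0 : 0 <= b := le_trans (vnorm_ge0 _) (hb 0).

Lemma green_term_bound (n k : int) : vnorm (G n k *m h k) <= K * rho ^+ `|n - k|%N * b.
Proof. by apply: le_trans (ler_vnormM _ _) _; rewrite ler_pM ?vnorm_ge0. Qed.

Lemma green_psum_bound (n : int) (N : nat) : vnorm (psum n N) <= 2 * K / (1 - rho) * b.
Proof.
apply: le_trans (ler_vnorm_sum _ _) _.
apply: (@le_trans _ _ (\sum_(0 <= i < (N + N).+1) K * b * rho ^+ `|(n + N%:Z)%R - i%:Z|%N)).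
  apply: ler_sum => i _; apply: le_trans (green_term_bound _ _) _.
  by rewrite mulrAC (_ : n - (i%:Z - N%:Z) = n + N%:Z - i%:Z) //; lia.
rewrite -mulr_sumr (_ : 2 * K / _ * b = K * b * (2 / (1 - rho))); last by ring.
by rewrite ler_wpM2l ?mulr_ge0 ?(ltW K0) // sum_geometric_dist.
Qed.

(** The window is centred at 0, not at [n]: it gains the indices [N + 1] and [-(N + 1)], whose
    distance to [n] is at least [N + 1 - |n|]. This explains the factor [rho ^+ |n|] in the
    denominator. *)
Lemma green_psum_incr (n : int) (N : nat) :
  vnorm (psum n N.+1 - psum n N) <= 2 * K * b / rho ^+ `|n|%N * rho ^+ N.
Proof.
have -> : psum n N.+1 - psum n N = G n (- N.+1%:Z) *m h (- N.+1%:Z)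
    + G n N.+1%:Z *m h N.+1%:Z.
  rewrite /green_psum (_ : (N.+1 + N.+1).+1 = (N + N).+3); last lia.
  rewrite big_nat_recr //= big_nat_recl //=.
  rewrite (eq_bigr (fun i : nat => G n (i%:Z - N%:Z) *m h (i%:Z - N%:Z))); last first.
    by move=> i _; rewrite (_ : i.+1%:Z - N.+1%:Z = i%:Z - N%:Z) //; lia.
  rewrite sub0r (_ : (N + N).+2%:Z - N.+1%:Z = N.+1%:Z); last lia.
  by rewrite [LHS]addrAC addrK.
have term k : (`|k| = N.+1)%N -> vnorm (G n k *m h k) <= K * b / rho ^+ `|n|%N * rho ^+ N.
  move=> kN; apply: le_trans (green_term_bound _ _) _.
  rewrite mulrAC -[X in _ <= X]mulrA ler_wpM2l ?mulr_ge0 ?(ltW K0) //.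
  rewrite mulrC ler_pdivlMr ?exprn_gt0 // -exprD.
  by apply: ler_wiXn2l; [exact: ltW|exact: ltW|lia].
have t1 := term (- N.+1%:Z) ltac:(lia); have t2 := term N.+1%:Z ltac:(lia).
apply: le_trans (ler_vnormD _ _) _; apply: le_trans (lerD t1 t2) _.
by rewrite -!mulrA -mulr2n mulr_natl.
Qed.

Lemma green_psum_cvg (n : int) (i : 'I_q) (j : 'I_1) :
  (fun N => complex.Re (psum n N i j)) @ \oo --> complex.Re (c n i j) /\
  (fun N => complex.Im (psum n N i j)) @ \oo --> complex.Im (c n i j).
Proof.
rewrite mxE /=; split.
  apply: (geometric_increments_cvg rho0 rho1 (D := 2 * K * b / rho ^+ `|n|%N)) => N.
  apply: le_trans (green_psum_incr n N).
  by have := normr_Re_vnorm (psum n N.+1 - psum n N) i j; rewrite !mxE raddfB.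
apply: (geometric_increments_cvg rho0 rho1 (D := 2 * K * b / rho ^+ `|n|%N)) => N.
apply: le_trans (green_psum_incr n N).
by have := normr_Im_vnorm (psum n N.+1 - psum n N) i j; rewrite !mxE raddfB.
Qed.

Lemma green_psum_near (n : int) (e : R) : 0 < e ->
  \forall N \near \oo, vnorm (psum n N - c n) <= cint_cst R q 1 * e.
Proof.
move=> e0.
have : \forall N \near \oo, forall i : 'I_q, forall j : 'I_1,
    `|complex.Re ((psum n N - c n) i j)| <= e /\ `|complex.Im ((psum n N - c n) i j)| <= e.
  apply: filter_forall => i; apply: filter_forall => j.
  have [/cvgrPdist_le/(_ _ e0) h1 /cvgrPdist_le/(_ _ e0) h2] := green_psum_cvg n i j.
  near=> N; rewrite !mxE !raddfB /=; split; rewrite distrC.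
    by near: N; move: h1; rewrite mxE.
  by near: N; move: h2; rewrite mxE.
by apply: filterS => N; exact: vnorm_le_entries.
Unshelve. all: by end_near. Qed.

Lemma green_sum_bound (n : int) : vnorm (c n) <= 2 * K / (1 - rho) * b.
Proof.
apply: (@vnorm_le_eps _ _ _ _ (cint_cst R q 1)); first exact: cint_cst_ge0.
move=> e e0.
have [N _ /(_ N (leqnn N)) /= pc] := green_psum_near n e0.
have := ler_vnormB (psum n N) (psum n N - c n); rewrite subKr => /le_trans; apply.
by apply: lerD => //; exact: green_psum_bound.
Qed.

Lemma green_sum_solution (n : int) : c (n + 1) = H n *m c n + h n.
Proof.
apply/eqP; rewrite -subr_eq0; apply/eqP; apply: vnorm_eq0.
apply/eqP; rewrite eq_le vnorm_ge0 andbT.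
apply: (@vnorm_le_eps _ _ _ _ (cint_cst R q 1 * (1 + vnorm (H n)))).
  by rewrite mulr_ge0 ?cint_cst_ge0 // addr_ge0 ?vnorm_ge0.
move=> e e0; rewrite add0r.
have [N [[h1 h2] nN]] := filter_ex (filterI (filterI (green_psum_near n e0)
  (green_psum_near (n + 1) e0)) (nbhs_infty_ge `|n|%N)).
rewrite (_ : c (n + 1) - _ = H n *m (psum n N - c n) - (psum (n + 1) N - c (n + 1))).
  apply: le_trans (ler_vnormB _ _) _; rewrite mulrDr mulr1 mulrDl addrC; apply: (lerD h2).
  apply: le_trans (ler_vnormM _ _) _.
  rewrite mulrAC [X in _ <= X]mulrC; exact: (ler_wpM2l (vnorm_ge0 _) h1).
rewrite (green_psum_step _ nN) mulmxBr; exact: subr_addC_shuffle.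
Qed.

End BoundedForcing.

(** The vector [xi n], the coordinate of [x] with respect to [Phi], is constant. Hence the [Pi] part
    of [x n] equals [G n k *m x (k + 1)] for every [k < n], and the complementary part is its
    negative for every [k >= n]. Letting [k] tend to either infinity, the decay of [G] kills
    both. *)
Lemma bounded_homogeneous_eq0 (x : int -> 'cV[C]_q) (b : R) :
  (forall n, vnorm (x n) <= b) -> (forall n, x (n + 1) = H n *m x n) ->
  forall n, x n = 0.
Proof.
move=> xb xH.
pose xi n := invmx (Phi n) *m x n.
have xi_step n : xi (n + 1) = xi n.
  have HE : H n = Phi (n + 1) *m invmx (Phi n) by rewrite PhiH mulmxK.
  by rewrite /xi xH HE -mulmxA mulKmx.
have xi_add (j : nat) n : xi (n + j%:Z) = xi n.
  elim: j => [|j IH]; first by rewrite addr0.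
  by rewrite -IH -[RHS]xi_step; congr xi; lia.
have xE n k : Phi n *m xi k = x n.
  suff -> : xi k = xi n by rewrite /xi mulKVmx.
  have [kn|/ltW nk] := lerP k n.
    by rewrite -(xi_add `|n - k|%N k); congr xi; lia.
  by rewrite -(xi_add `|k - n|%N n); congr xi; lia.
move=> n; rewrite -(xE n n) -[xi n]mul1mx -(subrK Pi 1%:M) mulmxDl mulmxDr.
have stable : Phi n *m (Pi *m xi n) = 0.
  apply: vnorm_eq0; apply: (le_geometric_eq0 (D := K * b) rho0 rho1 (vnorm_ge0 _)) => j.
  (* Here [k = n - (j + 1)], at distance [j + 1] from [n]; the bound is weakened to [rho ^+ j]. *)
  rewrite (_ : xi n = invmx (Phi (n - j.+1%:Z + 1)) *m x (n - j.+1%:Z + 1)); last first.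
    by rewrite -[RHS](xi_add j); congr xi; lia.
  have := G_bound n (n - j.+1%:Z); rewrite /Green (_ : n - j.+1%:Z < n); last lia.
  rewrite !mulmxA => Gb; apply: le_trans (ler_vnormM _ _) _.
  rewrite mulrAC ler_pM ?vnorm_ge0 //; apply: le_trans Gb _.
  by rewrite ler_wpM2l ?(ltW K0) //; apply: ler_wiXn2l; [exact: ltW|exact: ltW|lia].
have unstable : Phi n *m ((1%:M - Pi) *m xi n) = 0.
  apply: vnorm_eq0; apply: (le_geometric_eq0 (D := K * b) rho0 rho1 (vnorm_ge0 _)) => j.
  rewrite (_ : xi n = invmx (Phi (n + j%:Z + 1)) *m x (n + j%:Z + 1)); last first.
    by rewrite -[LHS](xi_add j.+1); congr xi; lia.
  have := G_bound n (n + j%:Z); rewrite /Green (_ : (n + j%:Z < n) = false); last lia.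
  rewrite vnormN !mulmxA => Gb; apply: le_trans (ler_vnormM _ _) _.
  rewrite mulrAC ler_pM ?vnorm_ge0 //; apply: le_trans Gb _.
  by rewrite (_ : `|n - (n + j%:Z)%R|%N = j) //; lia.
by rewrite stable unstable addr0.
Qed.

Lemma bounded_solution_unique (h : int -> 'cV[C]_q) (x : int -> 'cV[C]_q) (b b' : R) :
  (forall n, vnorm (h n) <= b) -> (forall n, vnorm (x n) <= b') ->
  (forall n, x (n + 1) = H n *m x n + h n) -> x = green_sum Phi Pi h.
Proof.
move=> hb xb xH; apply/funext => n; apply/eqP; rewrite -subr_eq0; apply/eqP.
apply: (@bounded_homogeneous_eq0 (fun n => x n - green_sum Phi Pi h n)
  (b' + 2 * K / (1 - rho) * b)) => {}n.
  apply: le_trans (ler_vnormB _ _) _; apply: lerD => //; exact: green_sum_bound.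
by rewrite xH (green_sum_solution hb) mulmxBr opprD addrACA subrr addr0.
Qed.

Lemma green_sum_almost_periodic (h : int -> 'cV[C]_q) (b : R) :
  (forall n, vnorm (h n) <= b) ->
  (forall e : R, 0 < e -> reldense_Z R [set T : int | forall n : int,
    vnorm (H (n + T) - H n) <= e /\ vnorm (h (n + T) - h n) <= e]) ->
  almost_periodic_Z (green_sum Phi Pi h).
Proof.
move=> hb apHh e e0; set c := green_sum Phi Pi h.
pose k := 2 * K / (1 - rho).
have k0 : 0 < k by rewrite divr_gt0 ?subr_gt0 // mulr_gt0.
have cb n : vnorm (c n) <= k * b := green_sum_bound hb n.
have kb0 : 0 <= k * b := le_trans (vnorm_ge0 _) (cb 0).
(* As [c] is bounded by [k * b], the forcing [g] below is at most [d * (k * b + 1)], and the Green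
   operator multiplies this by [k]. *)
pose d := e / (k * (k * b + 1)).
have d0 : 0 < d by rewrite divr_gt0 // mulr_gt0 // ltr_wpDl.
have [l l0 lT] := apHh _ d0; exists l => // m.
have [T HT mT] := lT m; exists T => // n.
(* The variation of [H] is moved into the forcing term, so the difference solves the system with the
   unshifted [H] and the same Green function applies. *)
pose g n := (H (n + T) - H n) *m c (n + T) + (h (n + T) - h n).
have gb i : vnorm (g i) <= d * (k * b + 1).
  have [H1 h1] := HT i; apply: le_trans (ler_vnormD _ _) _.
  rewrite mulrDr mulr1 lerD //; apply: le_trans (ler_vnormM _ _) _.
  by rewrite ler_pM ?vnorm_ge0.
have -> : c (n + T) - c n = green_sum Phi Pi g n.
  suff <- : (fun n => c (n + T) - c n) = green_sum Phi Pi g by [].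
  apply: (bounded_solution_unique gb (b' := k * b + k * b)) => i.
    exact: le_trans (ler_vnormB _ _) (lerD _ _).
  have cE j : c (j + 1) = H j *m c j + h j := green_sum_solution hb j.
  rewrite (addrAC i 1) !cE /g.
  rewrite mulmxBr mulmxBl opprD addrACA [RHS]addrA; congr (_ + _).
  by rewrite [RHS]addrC addrA subrK.
apply: le_trans (green_sum_bound gb n) _; rewrite -/k /d.
rewrite (_ : k * _ = e) //; field.
by rewrite !gt_eqF // ltr_wpDl.
Qed.

End GreenOperator.

Unset Implicit Arguments.
Set Strict Implicit.

Theorem theorem1 (R : realType) (q : nat)
  (tt : int -> R) (A B X : R -> 'M[R[i]]_q) (f : R -> 'cV[R[i]]_q)
  (Phi : int -> 'M[R[i]]_q) (Pi : 'M[R[i]]_q) (K rho : R) :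
  (* the sequence (t_n) *)
  (forall n : int, tt n < tt (n + 1)) ->
  (forall M : R, exists n : int, M < tt n) ->
  (forall M : R, exists n : int, tt n < M) ->
  (* standing assumptions *)
  loc_integrable A -> loc_integrable B -> loc_integrable f ->
  fundamental_matrix A X ->
  (forall (n : int) (t : R), tt n <= t <= tt (n + 1) -> Jn X B tt n t \in unitmx) ->
  (* (H1) *)
  almost_periodic_R A -> almost_periodic_R B ->
  (* (H3), including (H2) *)
  (forall e : R, 0 < e ->
     reldense_Z R [set T : int | forall (k : nat) (n : int),
        `|(tt (T + n + k%:Z) - tt (T + n)) - (tt (n + k%:Z) - tt n)| <= e]) ->
  (forall e : R, 0 < e ->
     reldense_R [set tau : R | forall t : R,
        (forall n : int, ~ (tt n - e < t < tt n + e)) ->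
        vnorm (f (t + tau) - f t) <= e]
     /\ exists2 d : R, 0 < d & forall (n : int) (t' tau' : R),
        `|tau'| <= d -> tt n <= t' <= tt (n + 1) -> tt n <= t' + tau' <= tt (n + 1) ->
        vnorm (f (t' + tau') - f t') <= e) ->
  (* (H6) *)
  (forall n : int, Phi (n + 1) = Hmat X B tt n *m Phi n) ->
  (forall n : int, Phi n \in unitmx) ->
  Pi *m Pi = Pi -> 0 < K -> 0 < rho -> rho < 1 ->
  (forall n k : int, vnorm (Green Phi Pi n k) <= K * rho ^+ `|n - k|%N) ->
  let h := hvec X f tt in
  let H := Hmat X B tt in
  let c := green_sum Phi Pi h in
  [/\ (* the series defining c(n) converges *)
      (forall (n : int) (i : 'I_q) (j : 'I_1),
         (fun N => complex.Re (green_psum Phi Pi h n N i j)) @ \oo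
           --> complex.Re (c n i j) /\
         (fun N => complex.Im (green_psum Phi Pi h n N i j)) @ \oo
           --> complex.Im (c n i j)),
      (* c is an almost periodic solution *)
      almost_periodic_Z c,
      (forall n : int, c (n + 1) = H n *m c n + h n),
      (* uniqueness among almost periodic solutions *)
      (forall d : int -> 'cV[R[i]]_q, almost_periodic_Z d ->
         (forall n : int, d (n + 1) = H n *m d n + h n) -> d = c)
    & (* the bound *)
      (supnormZ c <= ((2 * K / (1 - rho))%:E * supnormZ h)%E)%E].
Proof.
move=> tt_incr tt_ubd tt_lbd _ _ _ fX _ apA apB tt_ap f_hyp PhiH uPhi _ K0 r0 r1 Gb h H c.
have f_ap : almost_periodic_R f.
  by apply: (piecewise_almost_periodic tt_incr tt_ubd tt_lbd tt_ap) => e /f_hyp[].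
have apHh := Hmat_hvec_almost_periodic tt_incr tt_ap fX apA apB f_ap.
have aph : almost_periodic_Z h.
  move=> e /apHh[l l0 lT]; exists l => // m.
  by have [T HT mT] := lT m; exists T => // k; have [] := HT k.
have [b b0 hb] := almost_periodic_Z_bounded aph.
split.
- by move=> n i j; exact: (green_psum_cvg K0 r0 r1 Gb hb).
- exact: (green_sum_almost_periodic PhiH uPhi K0 r0 r1 Gb hb apHh).
- exact: (green_sum_solution PhiH uPhi K0 r0 r1 Gb hb).
- move=> d /almost_periodic_Z_bounded[b' _ db'] dH.
  exact: (bounded_solution_unique PhiH uPhi K0 r0 r1 Gb hb db' dH).
- have hsup k : ((vnorm (h k))%:E <= supnormZ h)%E.
    by apply: ereal_sup_ubound; exists k.
  (* Boundedness of [h] makes the supremum finite. The Green bound can then be applied with the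
     supremum itself in place of the auxiliary bound [b], which gives the stated constant. *)
  have sup_fin : supnormZ h \is a fin_num.
    rewrite fin_real //; apply/andP; split.
      exact: lt_le_trans (ltNyr _) (hsup 0).
    apply: le_lt_trans (ltry b); apply: ge_ereal_sup => _ [k _ <-].
    by rewrite lee_fin.
  rewrite -(fineK sup_fin) -EFinM; apply: ge_ereal_sup => _ [n _ <-].
  rewrite lee_fin; apply: (green_sum_bound K0 r0 r1 Gb) => k.
  by rewrite -lee_fin fineK.
Qed.
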